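(* Let $X$ be a finite non-empty subset of the unit sphere $S^{d-1}$ with degree $s$. Assume there exists a non-negative integer $w$ such that $b_w>0$ and $F_kF_l=0$ for all $(k,l)\in\{0,1,\ldots,w+s\}^2$ with $|k-l|\ge w+1$. Then $(X,R^X)$ is an $s$-class $Q$-polynomial association scheme.
   Context: Gegenbauer polynomials on $S^{d-1}$: $Q_0=1$, $Q_1(x)=dx$, $\frac{k+1}{d+2k}Q_{k+1}(x)=xQ_k(x)-\frac{d+k-3}{d+2k-4}Q_{k-1}(x)$. $b_k=\frac1{|X|}\sum_{x,y\in X}Q_k(\langle x,y\rangle)$. $\mathrm{Harm}_l(\mathbb{R}^d)$ is the space of harmonic homogeneous polynomials of degree $l$ with orthonormal basis $\phi_{l,1},\ldots,\phi_{l,h_l}$ for $\langle\phi,\psi\rangle=\frac1{|S^{d-1}|}\int_{S^{d-1}}\phi\psi\,d\sigma$; $H_l=(\phi_{l,i}(x))_{x\in X,1\le i\le h_l}$ and $F_l=\frac1{|X|}H_lH_l^T$. The degree set is $A(X)=\{\alpha_1,\ldots,\alpha_s\}=\{\langle x,y\rangle:x,y\in X,x\ne y\}$, $s=|A(X)|$; set $\alpha_0=1$, $R_i=\{(x,y)\in X\times X:\langle x,y\rangle=\alpha_i\}$ and $R^X=\{R_0,\ldots,R_s\}$. *)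

(* Defs.v *)
From HB Require Import structures.
From mathcomp Require Import all_boot all_order all_algebra finmap.
From mathcomp Require Import -(notations) mpoly.
From mathcomp Require Import all_classical all_reals all_analysis.
From mathcomp Require Import measurable_realfun.
Set Implicit Arguments.
Unset Strict Implicit.
Unset Printing Implicit Defensive.
Import Order.TTheory GRing.Theory Num.Theory.
Import numFieldNormedType.Exports.

Local Open Scope classical_set_scope.
Local Open Scope ring_scope.

(* Points of R^d are d-tuples of reals: these carry the product
   (= Borel) sigma-algebra, and [tnth x] is a valuation for [meval]. *)
Section Euclidean.
Variables (R : realType) (d : nat).
Implicit Types x y : d.-tuple R.

Definition dotp x y : R := \sum_(i < d) tnth x i * tnth y i.

Definition enorm x : R := Num.sqrt (dotp x x).

Definition unitv x : d.-tuple R := [tuple tnth x i / enorm x | i < d].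

Definition sphere : set (d.-tuple R) := [set x | dotp x x = 1].

End Euclidean.

(* d-dimensional Lebesgue measure, as an iterated product of the
   one-dimensional one transported along R * R^n ~ R^(n+1). *)
Section LebesgueStep.
Context (R : realType) (n : nat).
Local Notation RT := (measurableTypeR R).
Variable m : {sigma_finite_measure set (n.-tuple RT) -> \bar R}.

Definition tuple_cons (p : RT * n.-tuple RT) : n.+1.-tuple RT :=
  [tuple of p.1 :: p.2].

Definition tuple_uncons (t : n.+1.-tuple RT) : RT * n.-tuple RT :=
  (thead t, [tuple of behead t]).

Lemma measurable_tuple_cons : measurable_fun setT tuple_cons.
Proof. exact: measurable_cons. Qed.

Lemma measurable_tuple_uncons : measurable_fun setT tuple_uncons.
Proof.
apply/measurable_fun_pairP; split; first exact: measurable_tnth.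
exact: measurable_behead.
Qed.

Lemma tuple_consK : cancel tuple_cons tuple_uncons.
Proof. by move=> [a t]; congr pair; apply: val_inj. Qed.

Lemma tuple_unconsK : cancel tuple_uncons tuple_cons.
Proof. by move=> t; rewrite [RHS]tuple_eta; apply: val_inj. Qed.

Definition lebesgue_step (A : set (n.+1.-tuple RT)) : \bar R :=
  (lebesgue_measure \x m)%E (tuple_cons @^-1` A).

Let step_measure : {measure set (n.+1.-tuple RT) -> \bar R} :=
  measure_function_pushforward__canonical__measure_function_Measure
    (lebesgue_measure \x m)%E measurable_tuple_cons.

HB.instance Definition _ := isMeasure.Build _ _ _ lebesgue_step
  (measure0 step_measure) (measure_ge0 step_measure)
  (@measure_semi_sigma_additive _ _ _ step_measure).

Let step_sigma_finite : sigma_finite setT lebesgue_step.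
Proof.
have /sigma_finiteP[F [FT ndF Foo]] := sigma_finiteT (@lebesgue_measure R).
have /sigma_finiteP[G [GT ndG Goo]] := sigma_finiteT m.
exists (fun k => tuple_uncons @^-1` (F k `*` G k)).
  apply/esym; rewrite -subTset => t _.
  have [i _ Fi] : (\bigcup_k F k) (tuple_uncons t).1 by rewrite -FT.
  have [j _ Gj] : (\bigcup_k G k) (tuple_uncons t).2 by rewrite -GT.
  exists (maxn i j) => //; split.
    by move: Fi; exact/subsetPset/ndF/leq_maxl.
  by move: Gj; exact/subsetPset/ndG/leq_maxr.
move=> k; have [mF Fk] := Foo k; have [mG Gk] := Goo k; split.
  rewrite -[X in measurable X]setTI.
  by apply: measurable_tuple_uncons => //; exact: measurableX.
rewrite /lebesgue_step (_ : _ @^-1` _ = F k `*` G k); last first.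
  by rewrite -comp_preimage (_ : _ \o _ = id)//; exact/funext/tuple_consK.
by rewrite product_measure1E// lte_mul_pinfty// ge0_fin_numE.
Qed.

HB.instance Definition _ := Measure_isSigmaFinite.Build _ _ _ lebesgue_step
  step_sigma_finite.

End LebesgueStep.

Fixpoint lebesgue_tuple (R : realType) (n : nat) :
    {sigma_finite_measure set (n.-tuple (measurableTypeR R)) -> \bar R} :=
  match n with
  | 0 => dirac [tuple]
  | n'.+1 => lebesgue_step (lebesgue_tuple R n')
  end.

(* Surface measure of S^(d-1), as a Borel measure on R^d:
   sigma(A) = d * Leb {r u | 0 < r <= 1, u in A, |u| = 1}. *)
Section SurfaceMeasure.
Context (R : realType) (d : nat).
Local Notation RT := (measurableTypeR R).

Definition punctured_ball : set (d.-tuple RT) :=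
  [set x | 0 < enorm (x : d.-tuple R) <= 1].

Definition surface_measure (A : set (d.-tuple RT)) : \bar R :=
  (d%:R%:E * lebesgue_tuple R d ((@unitv R d) @^-1` A `&` punctured_ball))%E.

Lemma measurable_enorm :
  measurable_fun setT (@enorm R d : d.-tuple RT -> RT).
Proof.
have msqrt : measurable_fun [set: RT] (@Num.sqrt R : RT -> RT).
  by apply: continuous_measurable_fun; exact: sqrt_continuous.
apply: (measurableT_comp msqrt).
apply: measurable_sum => i.
by apply: measurable_funM; exact: measurable_tnth.
Qed.

Lemma measurable_unitv :
  measurable_fun setT (@unitv R d : d.-tuple RT -> d.-tuple RT).
Proof.
apply/measurable_fun_tnthP => i.
rewrite (_ : _ \o _ =
    fun x => tnth x i * (enorm (x : d.-tuple R)) `^ (-1)); last first.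
  by apply/funext => x /=; rewrite tnth_mktuple powR_inv1// sqrtr_ge0.
apply: measurable_funM; first exact: measurable_tnth.
exact: (measurableT_comp (measurable_powR _) measurable_enorm).
Qed.

Lemma measurable_punctured_ball : measurable punctured_ball.
Proof.
rewrite (_ : punctured_ball = setT `&` (@enorm R d) @^-1` `]0, 1]%classic).
  by apply: measurable_enorm => //; exact: measurable_itv.
by rewrite setTI; apply/seteqP; split => x /=; rewrite in_itv.
Qed.

Let surface : {measure set (d.-tuple RT) -> \bar R} :=
  mscale d%:R%:nng
    (measure_function_pushforward__canonical__measure_function_Measure
      (mrestr (lebesgue_tuple R d) measurable_punctured_ball) measurable_unitv).

HB.instance Definition _ := isMeasure.Build _ _ _ surface_measure
  (measure0 surface) (measure_ge0 surface)
  (@measure_semi_sigma_additive _ _ _ surface).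

End SurfaceMeasure.

Section Harmonic.
Variables (R : realType) (d : nat).
Implicit Types p q : mpoly d R.

Definition laplacian p : mpoly d R := \sum_(i < d) mderiv i (mderiv i p).

Definition harm (l : nat) p : Prop := p \is ishomog1 l mdeg /\ laplacian p = 0.

Definition harm_inner p q : R :=
  (fine (surface_measure (@sphere R d)))^-1 *
  \int[@surface_measure R d]_(x in @sphere R d)
     (meval (tnth x) p * meval (tnth x) q).

Definition harm_orthonormal_basis (l h : nat) (phi : 'I_h -> mpoly d R) : Prop :=
  [/\ forall i, harm l (phi i),
      forall i j, harm_inner (phi i) (phi j) = (i == j)%:R &
      forall p, harm l p -> exists c : 'I_h -> R, p = \sum_(i < h) c i *: phi i].

End Harmonic.

(* The coefficient (d+k-3)/(d+2k-4) of the recurrence is 0/0 for d = 2, k = 1;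
   there it is 1, its value for k = 1 in every other dimension (so that
   Q_k(cos t) = 2 cos (k t) when d = 2 and k > 0). *)
Definition gegenbauer_coef (R : realType) (d k : nat) : R :=
  if k == 1%N then 1 else (d%:R + k%:R - 3) / (d%:R + 2 * k%:R - 4).

(* [gegenbauer_pair R d k] is (Q_k, Q_(k+1)). *)
Fixpoint gegenbauer_pair (R : realType) (d k : nat) : {poly R} * {poly R} :=
  match k with
  | 0 => (1, d%:R *: 'X)
  | k'.+1 =>
      let Q := gegenbauer_pair R d k' in
      (Q.2, ((d%:R + 2 * k%:R) / k.+1%:R) *:
            ('X * Q.2 - gegenbauer_coef R d k *: Q.1))
  end.

Definition gegenbauer (R : realType) (d k : nat) : {poly R} :=
  (gegenbauer_pair R d k).1.

Section SphericalSet.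
Variables (R : realType) (d : nat) (X : {fset d.-tuple R}).

Definition degree_set : {fset R} :=
  [fset dotp x y | x in X, y in X & x != y]%fset.

Definition degree : nat := #|` degree_set|.

Definition b_coef (k : nat) : R :=
  (#|` X|%:R)^-1 * \sum_(x <- X) \sum_(y <- X) (gegenbauer R d k).[dotp x y].

Definition Hmx (h : nat) (phi : 'I_h -> mpoly d R) : 'M[R]_(#|{: X}|, h) :=
  \matrix_(x < #|{: X}|, i < h) meval (tnth (val (enum_val x))) (phi i).

Definition Fmx (h : nat) (phi : 'I_h -> mpoly d R) : 'M[R]_#|{: X}| :=
  (#|` X|%:R)^-1 *: (Hmx phi *m (Hmx phi)^T).

Definition inner_rel (s : nat) (alpha : s.-tuple R) (i : 'I_s.+1) : rel X :=
  fun x y => dotp (val x) (val y) == tnth [tuple of 1 :: alpha] i.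

End SphericalSet.
Arguments inner_rel {R d} X {s} alpha i x y.

Section Scheme.
Variables (R : realType) (T : finType) (s : nat) (r : 'I_s.+1 -> rel T).

Definition association_scheme : Prop :=
  [/\ (forall i, exists x, exists y, r i x y)
      /\ (forall x y, exists! i, r i x y),
      forall x y, r ord0 x y = (x == y),
      forall i x y, r i x y = r i y x &
      exists p : 'I_s.+1 -> 'I_s.+1 -> 'I_s.+1 -> nat,
        forall i j k x y, r k x y ->
          #|[pred z | r i x z && r j z y]| = p i j k].

Definition adjacency (i : 'I_s.+1) : 'M[R]_#|T| :=
  \matrix_(x < #|T|, y < #|T|) (r i (enum_val x) (enum_val y))%:R.

Definition bose_mesner : {vspace 'M[R]_#|T|} :=
  (\sum_(i < s.+1) <[adjacency i]>)%VS.

Definition bm_idempotent (M : 'M[R]_#|T|) : Prop :=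
  M \in bose_mesner /\ M *m M = M.

Definition primitive_idempotent (M : 'M[R]_#|T|) : Prop :=
  [/\ bm_idempotent M, M != 0 &
      forall M1 M2, bm_idempotent M1 -> bm_idempotent M2 ->
        M1 *m M2 = 0 -> M2 *m M1 = 0 -> M = M1 + M2 -> M1 = 0 \/ M2 = 0].

(* Entrywise, |T| E_i = v_i (|T| E_1) with deg v_i = i. For s = 0 the index
   [inord 1] is [ord0] and the condition holds with v_0 = 1. *)
Definition Q_polynomial : Prop :=
  exists E : 'I_s.+1 -> 'M[R]_#|T|,
    [/\ injective E,
        forall M, primitive_idempotent M <-> exists i, M = E i,
        E ord0 = (#|T|%:R)^-1 *: const_mx 1 &
        exists v : 'I_s.+1 -> {poly R}, forall i,
          size (v i) = i.+1 /\
          #|T|%:R *: E i = map_mx (horner (v i)) (#|T|%:R *: E (inord 1))].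

Definition Q_polynomial_scheme : Prop := association_scheme /\ Q_polynomial.

End Scheme.
Arguments Q_polynomial_scheme R {T s} r.

(* Main.v *)
(* Put u = <x,y> and let Z_l(.;y) be the homogeneous polynomial equal to
   Q_l(<x,y>) on the sphere; it is harmonic by the recurrence for Q_l.  Plane
   rotations are products of shears, so they preserve Lebesgue measure and the
   mean L over the sphere; hence L kills the infinitesimal rotations, and
   L(Lap q) = n (n + d - 2) L(q) for q homogeneous of degree n.  Applied to u^m p,
   this gives L(Z_l(.;y) p) = p(y) for p in Harm_l, which is the addition formula
   sum_i phi_(l,i)(x) phi_(l,i)(y) = Q_l(<x,y>).

   Thus F_k = Q_k(Gram)/|X| lies in the span A of the s + 1 adjacency matrices.
   From b_w > 0 and the three-term recurrence, tr(F_k F_(w+k)) > 0 for k <= s.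
   Since F_k F_l = 0 for l > k + w, the families
   F_0, ..., F_(k-1), I, F_(w+k+1), ..., F_(w+s) are linearly independent, hence
   bases of A.  Expanding N in A in such a basis shows that F_k N lies in
   span(F_0, ..., F_k): A is a commutative algebra and these spans are ideals.
   The primitive idempotents are the successive complements in this chain of
   ideals, so E_k is a polynomial of degree k in the Gram matrix. *)
Require Import Defs.
From HB Require Import structures.
From mathcomp Require Import all_boot all_order all_algebra finmap.
From mathcomp Require Import -(notations) mpoly.
From mathcomp Require Import all_classical all_reals all_analysis.
From mathcomp Require Import measurable_realfun.
From mathcomp Require Import ring lra zify.
Set Implicit Arguments.
Unset Strict Implicit.
Unset Printing Implicit Defensive.
Import Order.TTheory GRing.Theory Num.Theory.
Local Open Scope ring_scope.

(** * Integration over the sphere *)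

Section SphereIntegration.
Import numFieldNormedType.Exports.
Local Open Scope classical_set_scope.

Lemma lebesgue_measureD (R : realType) (c : R) (A : set R) : measurable A ->
  lebesgue_measure ((fun x : measurableTypeR R => x + c : measurableTypeR R) @^-1` A)
  = lebesgue_measure A.
Proof.
move=> mA.
have mf : measurable_fun setT (fun x : measurableTypeR R => x + c : measurableTypeR R).
  by apply: measurable_funD.
pose m :=
  measure_function_pushforward__canonical__measure_function_Measure (@lebesgue_measure R) mf.
apply/esym; apply: (@lebesgue_measure_unique R m) => // _ [[a b]] _ <-.
rewrite /m /= /pushforward (_ : _ @^-1` _ = `]a - c, b - c]); last first.
  by apply/seteqP; split => x /=; rewrite !in_itv/= ltrBlDr lerBrDr.
rewrite !lebesgue_measure_itv/= !lte_fin ltrBlDr subrK.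
by rewrite -!EFinD; congr (if _ then (_)%:E else _); ring.
Qed.

(** * Shears preserve Lebesgue measure *)

Section Shear.
Variable R : realType.
Local Notation RT := (measurableTypeR R).

Definition shear n (i : 'I_n) (g : n.-tuple RT -> R) (x : n.-tuple RT) : n.-tuple RT :=
  [tuple tnth x j + (if j == i then g x else 0) | j < n].

Lemma measurable_shear n (i : 'I_n) (g : n.-tuple RT -> R) :
  measurable_fun setT (g : _ -> RT) -> measurable_fun setT (shear i g).
Proof.
move=> mg; apply/measurable_fun_tnthP => j.
rewrite (_ : _ \o _ = fun x => tnth x j + (if j == i then g x else 0)); last first.
  by apply/funext => x /=; rewrite tnth_mktuple.
apply: measurable_funD; first exact: measurable_tnth.
by case: (j == i).
Qed.

(** Induction on the dimension, splitting off the first coordinate. If another coordinate is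
    sheared, the slices at a fixed first coordinate are themselves sheared and the induction
    hypothesis applies. If the first one is, exchanging the order of integration reduces to subsets
    of the line translated by a constant, because [g] does not see that coordinate. *)
Lemma shear_lebesgue n (i : 'I_n) (g : n.-tuple RT -> R) (A : set (n.-tuple RT)) :
  measurable_fun setT (g : _ -> RT) ->
  (forall x y, (forall j, j != i -> tnth x j = tnth y j) -> g x = g y) ->
  measurable A ->
  lebesgue_tuple R n (shear i g @^-1` A) = lebesgue_tuple R n A.
Proof.
elim: n => [|n IH] in i g A *; first by case: i.
move=> mg gi mA; rewrite /= /lebesgue_step.
have mB (B : set (n.+1.-tuple RT)) : measurable B ->
    measurable (@tuple_cons R n @^-1` B).
  by move=> mB'; rewrite -[X in measurable X]setTI; apply: measurable_tuple_cons.
have mS : measurable (shear i g @^-1` A).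
  by rewrite -[X in measurable X]setTI; apply: measurable_shear.
case: (unliftP ord0 i) => [k ik|i0].
- apply: eq_integral => a _ /=.
  rewrite -[RHS](IH k (fun u => g (tuple_cons (a, u))) (xsection _ a)).
  + congr (lebesgue_tuple R n _); apply/funext=> u /=.
    rewrite /xsection/= !inE /=; congr (A _); apply: eq_from_tnth => j.
    rewrite tnth_mktuple ik; case: (unliftP ord0 j) => [j'|] ->.
      by rewrite !tnthS tnth_mktuple (inj_eq lift_inj).
    by rewrite !tnth0 (negbTE (neq_lift _ _)) addr0.
  + apply: (measurableT_comp mg).
    by apply: (measurableT_comp (@measurable_tuple_cons R n)); exact: measurable_pair1.
  + move=> x y xy; apply: gi => j ji; case: (unliftP ord0 j) ji => [j'|] ->.
      by rewrite ik (inj_eq lift_inj) !tnthS => /xy.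
    by rewrite !tnth0.
  + by apply: measurable_xsection; exact: mB.
- have swap B : measurable B ->
      (lebesgue_measure \x lebesgue_tuple R n)%E (@tuple_cons R n @^-1` B) =
      (lebesgue_measure \x^ lebesgue_tuple R n)%E (@tuple_cons R n @^-1` B).
    move=> /mB mB'; apply: product_measure_unique => // *.
    exact: product_measure2E.
  rewrite !swap//; apply: eq_integral => u _ /=.
  have g0 a : g (tuple_cons (a, u)) = g (tuple_cons (0, u)).
    apply: gi => j; rewrite i0; case: (unliftP ord0 j) => [j'|] ->.
      by rewrite !tnthS.
    by rewrite eqxx.
  rewrite -[RHS](@lebesgue_measureD _ (g (tuple_cons (0, u)))); last first.
    by apply: measurable_ysection; exact: mB.
  congr lebesgue_measure; apply/funext=> a /=.
  rewrite /ysection/= !inE /=; congr (A _); apply: eq_from_tnth => j.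
  rewrite tnth_mktuple i0 g0; case: (unliftP ord0 j) => [j'|] ->.
    by rewrite !tnthS eq_sym (negbTE (neq_lift _ _)) addr0.
  by rewrite !tnth0 eqxx.
Qed.
End Shear.

(** * Plane rotations preserve the surface measure *)

Section Rotation.
Variables (R : realType) (d : nat) (i j : 'I_d).
Hypothesis ij : i != j.
Local Notation RT := (measurableTypeR R).

Definition plane_rot (c s : R) (x : d.-tuple RT) : d.-tuple RT :=
  [tuple if k == i then c * tnth x i - s * tnth x j
         else if k == j then s * tnth x i + c * tnth x j else tnth x k | k < d].

Lemma measurable_plane_rot c s : measurable_fun setT (plane_rot c s).
Proof.
apply/measurable_fun_tnthP => k.
rewrite (_ : _ \o _ = fun x => if k == i then c * tnth x i - s * tnth x j
    else if k == j then s * tnth x i + c * tnth x j else tnth x k); last first.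
  by apply/funext => x /=; rewrite tnth_mktuple.
case: (k == i); first by apply: measurable_funB; apply: measurable_funM => //;
  exact: measurable_tnth.
case: (k == j); last exact: measurable_tnth.
by apply: measurable_funD; apply: measurable_funM => //; exact: measurable_tnth.
Qed.

Lemma dotp_plane_rot c s x : c ^+ 2 + s ^+ 2 = 1 ->
  dotp (plane_rot c s x) (plane_rot c s x) = dotp x x.
Proof.
move=> cs; rewrite /dotp.
have split_sum (f : 'I_d -> R) :
    \sum_k f k = f i + f j + \sum_(k | (k != i) && (k != j)) f k.
  by rewrite (bigD1 i)//= (bigD1 j)/= ?addrA// eq_sym.
rewrite !split_sum !tnth_mktuple !eqxx eq_sym (negbTE ij); congr (_ + _).
  by rewrite -[RHS]mul1r -cs; ring.
by apply: eq_bigr => k /andP[ki kj]; rewrite tnth_mktuple (negbTE ki) (negbTE kj).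
Qed.

(* A rotation is the product of three shears. *)
Lemma lebesgue_plane_rot (t : R) (A : set (d.-tuple RT)) : measurable A ->
  lebesgue_tuple R d (plane_rot ((1 - t ^+ 2) / (1 + t ^+ 2)) (2 * t / (1 + t ^+ 2)) @^-1` A)
  = lebesgue_tuple R d A.
Proof.
move=> mA.
have t1 : 1 + t ^+ 2 != 0 by rewrite gt_eqF// ltr_pwDl// sqr_ge0.
pose g (a : R) k (x : d.-tuple RT) : R := a * tnth x k.
have mg a k : measurable_fun setT (g a k : _ -> RT).
  by apply: measurable_funM => //; exact: measurable_tnth.
have sp k l a B : l != k -> measurable B ->
    lebesgue_tuple R d (shear k (g a l) @^-1` B) = lebesgue_tuple R d B.
  by move=> lk mB; apply: shear_lebesgue => // x y xy; rewrite /g xy.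
have ms k l a B : measurable B -> measurable (shear k (g a l) @^-1` B).
  by move=> mB; rewrite -[X in measurable X]setTI; apply: measurable_shear.
(* With t = tan(theta/2), the rotation by theta factors into shears with parameters -tan(theta/2),
   sin(theta), -tan(theta/2). The rational parametrisation also makes rotated polynomials polynomial
   in t up to a power of 1 + t^2. *)
rewrite -[RHS](sp i j (- t)) 1?eq_sym//.
rewrite -[RHS](sp j i (2 * t / (1 + t ^+ 2)))//; last exact: ms.
rewrite -[RHS](sp i j (- t)) 1?eq_sym//; last by apply: (ms); apply: (ms).
congr (lebesgue_tuple R d _); apply/funext => x /=; congr (A _).
apply: eq_from_tnth => k; rewrite /g !tnth_mktuple.
have ji : (j == i) = false by rewrite eq_sym; exact: negbTE.
have [->|ki] := eqVneq k i; first by rewrite ?eqxx ?(negbTE ij) ?ji ?addr0; field.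
have [->|kj] := eqVneq k j; first by rewrite ?eqxx ?(negbTE ij) ?ji ?addr0; field.
by rewrite !addr0.
Qed.

(** A rotation preserves the norm, so it commutes with [unitv] and fixes the punctured ball: the
    cone over a preimage is the preimage of the cone. *)
Lemma surface_plane_rot (t : R) (A : set (d.-tuple RT)) : measurable A ->
  surface_measure (plane_rot ((1 - t ^+ 2) / (1 + t ^+ 2)) (2 * t / (1 + t ^+ 2)) @^-1` A)
  = surface_measure A.
Proof.
move=> mA; rewrite /surface_measure; set c := _ / _; set s := _ / _.
have t1 : 1 + t ^+ 2 != 0 by rewrite gt_eqF// ltr_pwDl// sqr_ge0.
have cs : c ^+ 2 + s ^+ 2 = 1 by rewrite /c /s; field.
rewrite -[in RHS](@lebesgue_plane_rot t); last first.
  apply: measurableI; last exact: measurable_punctured_ball.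
  by rewrite -[X in measurable X]setTI; exact: measurable_unitv.
have nrm x : enorm (plane_rot c s x) = enorm x by rewrite /enorm dotp_plane_rot.
congr (_ * lebesgue_tuple R d _)%E; apply/funext => x.
rewrite /preimage /setI /punctured_ball /mkset /= -/c -/s nrm; congr (A _ /\ _).
apply: eq_from_tnth => k; rewrite !tnth_mktuple nrm !mulrA.
by case: ifP => _; [rewrite mulrBl|case: ifP => _; rewrite ?mulrDl].
Qed.
End Rotation.

(** * The mean over the sphere as a rotation-invariant linear functional *)

Section SphereMean.
Variables (R : realType) (d : nat).
Local Notation RT := (measurableTypeR R).
Local Notation sigma := (@surface_measure R d).
Local Notation sph := (@sphere R d : set (d.-tuple RT)).
Implicit Types p q : mpoly d R.

Definition smean p : R :=
  (fine (sigma sph))^-1 * \int[sigma]_(x in sph) meval (tnth x) p.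

Lemma harm_innerE p q : harm_inner p q = smean (p * q).
Proof.
rewrite /harm_inner /smean; congr (_ * _).
by apply: eq_Rintegral => x _; rewrite mevalM.
Qed.

Lemma measurable_sphere : measurable sph.
Proof.
rewrite (_ : sph = setT `&` (@enorm R d) @^-1` [set 1]).
  by apply: measurable_enorm => //; exact: measurable_set1.
rewrite setTI; apply/seteqP; split => x /=.
  by rewrite /sphere /enorm /= => ->; rewrite sqrtr1.
rewrite /sphere /enorm /= => /(congr1 (fun z => z ^+ 2)).
rewrite sqr_sqrtr ?expr1n//; apply: sumr_ge0 => k _.
by rewrite -expr2 sqr_ge0.
Qed.

Lemma measurable_meval p :
  measurable_fun setT (fun x : d.-tuple RT => meval (tnth x) p : RT).
Proof.
rewrite (_ : (fun x => _) = (fun x => \sum_(m <- msupp p)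
    mcoeff m p * \prod_k tnth x k ^+ m k)); last first.
  by apply/funext => x; rewrite mevalE.
apply: measurable_sum => m; apply: measurable_funM => //.
apply: measurable_prod => k _; apply: measurable_funX; exact: measurable_tnth.
Qed.

Lemma sphere_coord (x : d.-tuple R) k : sphere x -> `|tnth x k| <= 1.
Proof.
rewrite /sphere /dotp /= => x1; rewrite -(@expr_le1 _ 2)// real_normK ?num_real//.
rewrite -x1 (bigD1 k)//= -expr2 lerDl; apply: sumr_ge0 => l _.
by rewrite -expr2 sqr_ge0.
Qed.

Lemma bounded_meval p : [bounded meval (tnth x) p | x in sph].
Proof.
exists (\sum_(m <- msupp p) `|mcoeff m p|); split; first exact: num_real.
move=> M ltM x xS; apply: le_trans (ltW ltM); rewrite mevalE.
apply: le_trans (ler_norm_sum _ _ _) _; apply: ler_sum => m _.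
rewrite normrM ler_piMr// normr_prod; apply: prodr_ile1 => k _.
by rewrite normr_ge0 normrX exprn_ile1// sphere_coord.
Qed.

Lemma integrable_meval p : fine (sigma sph) != 0 ->
  sigma.-integrable sph (EFin \o (fun x => meval (tnth x) p)).
Proof.
move=> s0; apply: measurable_bounded_integrable.
- exact: measurable_sphere.
- have : (sigma sph < +oo)%E by move: s0; case: (sigma sph) => [r||] /=; rewrite ?ltry ?eqxx.
  by [].
- exact: measurable_funTS (measurable_meval p).
- exact: bounded_meval.
Qed.

Lemma smean_is_linear : linear_for *%R smean.
Proof.
move=> a p q; rewrite /smean.
(* If [fine] sends the mass of the sphere to 0, the inverse is 0 by convention and the mean vanishes
   identically. Otherwise the mass is finite and polynomials, bounded on the sphere, are
   integrable. *)
have [->|s0] := eqVneq (fine (sigma sph)) 0; first by rewrite invr0 !mul0r mulr0 addr0.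
under eq_Rintegral do rewrite mevalD mevalZ.
have mS := measurable_sphere.
rewrite RintegralD//; last 2 first.
- have := integrable_meval (a *: p) s0; apply: eq_integrable => // x _ /=.
  by rewrite mevalZ.
- exact: integrable_meval.
by rewrite RintegralZl//; [rewrite mulrDr mulrCA|exact: integrable_meval].
Qed.
HB.instance Definition _ := GRing.isLinear.Build R (mpoly d R) R *%R smean smean_is_linear.

Lemma smeanZ a p : smean (a *: p) = a * smean p.
Proof. exact: linearZ. Qed.

Lemma smeanD p q : smean (p + q) = smean p + smean q.
Proof. exact: raddfD. Qed.

Lemma smeanB p q : smean (p - q) = smean p - smean q.
Proof. exact: raddfB. Qed.

Lemma smean_sum I (r : seq I) (P : pred I) (F : I -> mpoly d R) :
  smean (\sum_(i <- r | P i) F i) = \sum_(i <- r | P i) smean (F i).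
Proof. exact: raddf_sum. Qed.

Lemma eq_smean p q : (forall x : d.-tuple R, sphere x -> meval (tnth x) p = meval (tnth x) q) ->
  smean p = smean q.
Proof.
move=> pq; rewrite /smean; congr (_ * _).
by apply: eq_Rintegral => x; rewrite inE; exact: pq.
Qed.

Lemma smean1 : fine (sigma sph) != 0 -> smean 1 = 1.
Proof.
move=> s0; rewrite /smean (@eq_Rintegral _ _ _ _ _ (cst 1)).
  by rewrite Rintegral_cst ?mul1r ?mulVf//; exact: measurable_sphere.
by move=> x _; rewrite meval1.
Qed.

Lemma smean_plane_rot (i j : 'I_d) (t : R) p q : i != j ->
  (forall x : d.-tuple R, meval (tnth x) q = meval (tnth
    (plane_rot i j ((1 - t ^+ 2) / (1 + t ^+ 2)) (2 * t / (1 + t ^+ 2)) x)) p) ->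
  smean q = smean p.
Proof.
move=> ij qp.
have t1 : 1 + t ^+ 2 != 0 by rewrite gt_eqF// ltr_pwDl// sqr_ge0.
move: qp; set c := _ / _; set s := _ / _ => qp.
have cs : c ^+ 2 + s ^+ 2 = 1 by rewrite /c /s; field.
have mr := @measurable_plane_rot R d i j c s.
rewrite /smean.
have [->|s0] := eqVneq (fine (sigma sph)) 0; first by rewrite invr0 !mul0r.
congr (_ * _); rewrite /Rintegral; congr fine.
have sE : plane_rot i j c s @^-1` sph = sph.
  by apply/seteqP; split=> x; rewrite /sphere /= dotp_plane_rot.
rewrite [RHS](eq_measure_integral
  (measure_function_pushforward__canonical__measure_function_Measure sigma mr)); last first.
  by move=> A mA _; apply/esym; exact: surface_plane_rot.
rewrite integral_pushforward/=; last 4 first.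
- exact: mr.
- by apply: measurableT_comp => //; exact: measurable_meval.
- rewrite sE; apply: eq_integrable (integrable_meval q s0) => //.
    exact: measurable_sphere.
  by move=> x _ /=; rewrite qp.
- exact: measurable_sphere.
by rewrite sE; apply: eq_integral => x _ /=; rewrite qp.
Qed.
End SphereMean.

End SphereIntegration.

(** * The addition formula *)

Section PolynomialCalculus.
Variables (R : realType) (d : nat).
Implicit Types (p q : mpoly d R) (i j k : 'I_d) (m : multinom d).
Local Notation xv i := (mpolyX R (mnm1 i)).
Local Notation Homog n := (@ishomog1 d R n mdeg).

Lemma mderiv_xv i j : mderiv i (xv j) = (i == j)%:R :> mpoly d R.
Proof.
rewrite mderivX mnm1E eq_sym; case: eqP => [->|_]; last by rewrite scale0r.
rewrite scale1r (_ : mnm_sub _ _ = mnm0) ?mpolyX0//.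
by apply/mnmP => k; rewrite mnmBE subnn mnm0E.
Qed.

Lemma xv_mderivX i m : xv i * mderiv i (mpolyX R m) = (m i)%:R *: mpolyX R m.
Proof.
rewrite mderivX -scalerAr; have [->|mi] := eqVneq (m i) 0%N; first by rewrite !scale0r.
congr (_ *: _); rewrite -mpolyXD; congr mpolyX; apply/mnmP => k.
rewrite mnmDE mnmBE mnm1E; case: eqP => [<-|_]; last by rewrite add0n subn0.
by rewrite subnKC// lt0n.
Qed.

Lemma mderiv_homog n j q : q \is Homog n -> mderiv j q \is Homog n.-1.
Proof.
move=> /dhomogP hq; rewrite [q]mpolyE raddf_sum/= big_seq; apply: rpred_sum => m mq.
rewrite mderivZ rpredZ// mderivX; have [->|mi] := eqVneq (m j) 0%N.
  by rewrite scale0r rpred0.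
rewrite rpredZ// dhomogX -(hq m mq); apply/eqP.
suff E : mdeg m = (mdeg (mnm_sub m (mnm1 j))).+1 by exact/esym/(congr1 predn E).
rewrite -addn1 -(mdeg1 j) -mdegD; congr mdeg; apply/mnmP => k.
rewrite mnmDE mnmBE mnm1E; case: eqP => [<-|_]; last by rewrite addn0 subn0.
by rewrite subnK// lt0n.
Qed.

Lemma xv_homog i : xv i \is Homog 1.
Proof. by rewrite dhomogX; apply/eqP; exact: mdeg1. Qed.

Lemma xv_mderiv_homog n i j q : q \is Homog n -> xv i * mderiv j q \is Homog n.
Proof.
case: n => [|n] hq; last exact: (dhomogM (xv_homog i) (mderiv_homog j hq)).
suff -> : mderiv j q = 0 by rewrite mulr0 rpred0.
move/dhomogP: hq => hq; rewrite [q]mpolyE raddf_sum/= big_seq big1// => m mq.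
have /eqP : mdeg m = 0%N by exact: hq.
by rewrite mdeg_eq0 => /eqP ->; rewrite mpolyX0 mderivZ -mpolyC1 mderivC scaler0.
Qed.

Lemma euler n q : q \is Homog n -> \sum_i xv i * mderiv i q = n%:R *: q.
Proof.
move=> /dhomogP hq; rewrite [q in RHS]mpolyE scaler_sumr.
transitivity (\sum_i \sum_(m <- msupp q) mcoeff m q *: (xv i * mderiv i (mpolyX R m))).
  apply: eq_bigr => i _; rewrite {1}[q]mpolyE raddf_sum mulr_sumr.
  by apply: eq_bigr => m _; rewrite /= mderivZ scalerAr.
rewrite exchange_big /=; apply: eq_big_seq => m mq.
under eq_bigr => i _ do rewrite xv_mderivX.
rewrite -scaler_sumr -scaler_suml !scalerA; rewrite [X in _ = X *: _]mulrC; congr ((_ * _) *: _).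
by rewrite -natr_sum -mdegE; congr (_%:R); exact: hq.
Qed.

(** Differentiate Euler's identity for [q]. The factor is [n%:R - 1] in R, not a truncated
    predecessor, so that degree 0 needs no separate treatment. *)
Lemma euler_mderiv n j q : q \is Homog n ->
  \sum_i xv i * mderiv i (mderiv j q) = (n%:R - 1) *: mderiv j q.
Proof.
move=> /euler/(congr1 (mderiv j)); rewrite raddf_sum/= mderivZ => E.
rewrite scalerBl scale1r -E.
under [X in _ = X - _]eq_bigr => i _ do rewrite mderivM mderiv_xv (mderiv_comm i j).
rewrite big_split/= (_ : \sum_i (j == i)%:R * mderiv i q = mderiv j q).
  by rewrite addrAC subrr add0r.
rewrite (bigD1 j)//= eqxx mul1r big1 ?addr0// => i.
by rewrite eq_sym => /negbTE ->; rewrite mul0r.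
Qed.

Lemma mderivXn (y : R) i q n : mderiv i q = y%:A -> 
  mderiv i (q ^+ n) = (n%:R * y) *: q ^+ n.-1.
Proof.
move=> qy; elim: n => [|n IH]; first by rewrite expr0 -mpolyC1 mderivC mul0r scale0r.
rewrite exprS mderivM IH qy mulr_algl.
case: n {IH} => [|n] /=; first by rewrite !expr0 mul0r scale0r mulr0 addr0 mul1r.
by rewrite -scalerAr -exprS -scalerDl -[n.+2]addn1 natrD; congr (_ *: _); ring.
Qed.

Lemma laplacianD p q : laplacian (p + q) = laplacian p + laplacian q.
Proof. by rewrite /laplacian -big_split/=; apply: eq_bigr => i _; rewrite !mderivD. Qed.

Lemma laplacianZ c p : laplacian (c *: p) = c *: laplacian p.
Proof. by rewrite /laplacian scaler_sumr; apply: eq_bigr => i _; rewrite !mderivZ. Qed.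

Lemma laplacianB p q : laplacian (p - q) = laplacian p - laplacian q.
Proof. by rewrite /laplacian -sumrB; apply: eq_bigr => i _; rewrite !mderivB. Qed.

Lemma laplacianM p q : laplacian (p * q) =
  laplacian p * q + 2 * \sum_i mderiv i p * mderiv i q + p * laplacian q.
Proof.
rewrite /laplacian mulr_suml !mulr_sumr -!big_split /=; apply: eq_bigr => i _.
by rewrite !mderivM !mderivD !mderivM; ring.
Qed.

End PolynomialCalculus.

(** * Rotated coordinates as polynomials in t over an abstract coefficient ring *)

Section PolynomialCoefficients.
Variable A : comNzRingType.
Implicit Types (p q : {poly A}) (f g c : A).

Lemma coef1M p q : (p * q)`_1 = p`_0 * q`_1 + p`_1 * q`_0.
Proof. by rewrite coefM !big_ord_recl big_ord0 addr0. Qed.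

Lemma horner_rotB f g c : ((1 - 'X^2) * f%:P - 2%:R * 'X * g%:P).[c] =
  (1 - c ^+ 2) * f - 2 * c * g.
Proof. by rewrite !hornerE. Qed.

Lemma horner_rotD f g c : (2%:R * 'X * f%:P + (1 - 'X^2) * g%:P).[c] =
  2 * c * f + (1 - c ^+ 2) * g.
Proof. by rewrite !hornerE. Qed.

Lemma horner_rot1 f c : ((1 + 'X^2) * f%:P).[c] = (1 + c ^+ 2) * f.
Proof. by rewrite !hornerE. Qed.

Lemma coef_rotB f g :
  ((1 - 'X^2) * f%:P - 2%:R * 'X * g%:P)`_0 = f /\
  ((1 - 'X^2) * f%:P - 2%:R * 'X * g%:P)`_1 = - (2 * g).
Proof.
by split; rewrite coefB !coefMC coefB coef1 coefXn -polyC_natr coefCM coefX /=; ring.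
Qed.

Lemma coef_rotD f g :
  (2%:R * 'X * f%:P + (1 - 'X^2) * g%:P)`_0 = g /\
  (2%:R * 'X * f%:P + (1 - 'X^2) * g%:P)`_1 = 2 * f.
Proof.
by split; rewrite coefD !coefMC coefB coef1 coefXn -polyC_natr coefCM coefX /=; ring.
Qed.

Lemma coef_rot1 f : ((1 + 'X^2) * f%:P)`_0 = f /\
  ((1 + 'X^2) * f%:P)`_1 = 0.
Proof. by split; rewrite coefMC coefD coef1 coefXn /=; ring. Qed.
End PolynomialCoefficients.

(** * Infinitesimal rotations *)

Section RotationGenerator.
Variables (R : realType) (d : nat) (i j : 'I_d).
Hypothesis ij : i != j.
Implicit Types (p q : mpoly d R) (k : 'I_d) (m : multinom d).
Local Notation xv i := (mpolyX R (mnm1 i)).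
Local Notation Homog n := (@ishomog1 d R n mdeg).

Definition rot_gen q : mpoly d R := xv i * mderiv j q - xv j * mderiv i q.

(* Substituting (1 + t^2) R_t, where R_t is the rotation by the angle
   2 arctan t, gives polynomials in t with coefficients in R[x]. *)
Definition rot_coord k : {poly mpoly d R} :=
  if k == i then (1 - 'X^2) * (xv i)%:P - 2%:R * 'X * (xv j)%:P
  else if k == j then 2%:R * 'X * (xv i)%:P + (1 - 'X^2) * (xv j)%:P
  else (1 + 'X^2) * (xv k)%:P.

Definition rot_subst q : {poly mpoly d R} :=
  mmap (polyC \o @mpolyC d R) rot_coord q.

(** Each of the n variables of a monomial of degree n contributes one factor 1 + t^2; homogeneity
    makes this power common to all monomials. *)
Lemma meval_rot_subst n (t : R) q (x : d.-tuple R) : q \is Homog n ->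
  meval (tnth x) (rot_subst q).[mpolyC d t] = (1 + t ^+ 2) ^+ n * meval (tnth
    (plane_rot i j ((1 - t ^+ 2) / (1 + t ^+ 2)) (2 * t / (1 + t ^+ 2)) x)) q.
Proof.
move=> /dhomogP hq.
have t1 : 1 + t ^+ 2 != 0 by rewrite gt_eqF// ltr_pwDl// sqr_ge0.
rewrite /rot_subst /mmap horner_sum raddf_sum mevalE mulr_sumr/=.
apply: eq_big_seq => m mq; rewrite hornerM hornerC mevalM mevalC mulrCA.
congr (_ * _); rewrite /mmap1 -(hq m mq) /= mdegE -prodrXr -big_split/=.
rewrite horner_prod rmorph_prod/=; apply: eq_bigr => k _.
rewrite horner_exp rmorphXn/= -exprMn; congr (_ ^+ _).
have mC c : meval (tnth x) (mpolyC d c) = c by exact: mevalC.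
rewrite tnth_mktuple /rot_coord; case: ifP => _; last case: ifP => _.
- rewrite horner_rotB mevalB !mevalM mevalB meval1 rmorphXn rmorph_nat !mevalXU/= mC.
  by field.
- rewrite horner_rotD mevalD !mevalM mevalB meval1 rmorphXn rmorph_nat !mevalXU/= mC.
  by field.
- by rewrite horner_rot1 mevalM mevalD meval1 rmorphXn/= mC mevalXU.
Qed.

Lemma rot_gen_is_linear : linear rot_gen.
Proof.
by move=> a p q; rewrite /rot_gen !mderivD !mderivZ !mulrDr -!scalerAr scalerBr; ring.
Qed.
HB.instance Definition _ :=
  GRing.isLinear.Build R (mpoly d R) (mpoly d R) _ rot_gen rot_gen_is_linear.

Lemma rot_genM p q : rot_gen (p * q) = rot_gen p * q + p * rot_gen q.
Proof. by rewrite /rot_gen !mderivM; ring. Qed.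

(** [a] and [b] stand for the coefficients of t^0 and t^1 of a ring morphism into polynomials in t,
    so [b] is a derivation along [a] and both are determined by constants and variables. The factor
    2 is the derivative at 0 of the angle 2 arctan t. *)
Lemma derivation_eq_rot_gen (a b : mpoly d R -> mpoly d R) :
  {morph a : p q / p + q} -> {morph b : p q / p + q} ->
  {morph a : p q / p * q} -> (forall p q, b (p * q) = a p * b q + b p * a q) ->
  (forall c, a (mpolyC d c) = mpolyC d c) -> (forall c, b (mpolyC d c) = 0) ->
  (forall k, a (xv k) = xv k) -> (forall k, b (xv k) = 2 * rot_gen (xv k)) ->
  forall q, a q = q /\ b q = 2 * rot_gen q.
Proof.
move=> aD bD aM bM aC bC aX bX q.
pose P q := a q = q /\ b q = 2 * rot_gen q.
have PC c : P (mpolyC d c).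
  by split; rewrite ?aC// bC /rot_gen !mderivC !mulr0 subr0 mulr0.
have PM p p' : P p -> P p' -> P (p * p').
  move=> -[p0 p1] [p0' p1']; rewrite /P aM bM p0 p1 p0' p1'.
  by split => //; rewrite rot_genM; ring.
have PD p p' : P p -> P p' -> P (p + p').
  move=> -[p0 p1] [p0' p1']; rewrite /P aD bD p0 p1 p0' p1' -mulrDr; split=> //.
  by congr (_ * _); apply/esym; exact: raddfD.
have PXm m : P (mpolyX R m).
  rewrite mpolyXE_id; apply: big_rec => [|k p _ Pp].
    by rewrite -mpolyC1; exact: PC.
  apply: (PM) => //; elim: (m k) => [|n IH].
    by rewrite expr0 -mpolyC1; exact: PC.
  by rewrite exprS; apply: PM.
rewrite -/(P q) [q]mpolyE; apply: big_rec => [|m p _ Pp].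
  by rewrite -(mpolyC0 d); exact: PC.
by apply: (PD) => //; rewrite -mul_mpolyC; apply: PM.
Qed.

Lemma rot_subst_coef q : (rot_subst q)`_0 = q /\ (rot_subst q)`_1 = 2 * rot_gen q.
Proof.
apply: (@derivation_eq_rot_gen (fun q => (rot_subst q)`_0) (fun q => (rot_subst q)`_1)).
- by move=> p p'; exact: etrans (congr1 (fun r : {poly _} => r`_0) (raddfD _ p p')) (coefD _ _ _).
- by move=> p p'; exact: etrans (congr1 (fun r : {poly _} => r`_1) (raddfD _ p p')) (coefD _ _ _).
- by move=> p p'; exact: etrans (congr1 (fun r : {poly _} => r`_0) (rmorphM _ p p')) (coef0M _ _).
- by move=> p p'; exact: etrans (congr1 (fun r : {poly _} => r`_1) (rmorphM _ p p')) (coef1M _ _).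
- by move=> c; rewrite /rot_subst mmapC /= coefC.
- by move=> c; rewrite /rot_subst mmapC /= coefC.
- move=> k; rewrite /rot_subst mmapX mmap1U /rot_coord.
  have [->|ki] := eqVneq k i; first by have [] := coef_rotB (xv i) (xv j).
  have [->|kj] := eqVneq k j; first by have [] := coef_rotD (xv i) (xv j).
  by have [] := coef_rot1 (xv k).
- move=> k; rewrite /rot_subst mmapX mmap1U /rot_gen !mderiv_xv /rot_coord.
  have [->|ki] := eqVneq k i.
    apply: etrans (coef_rotB (xv i) (xv j)).2 _.
    by rewrite eq_sym (negbTE ij) /=; ring.
  case: eqVneq => kj.
    by apply: etrans (coef_rotD (xv i) (xv j)).2 _; rewrite /=; ring.
  by apply: etrans (coef_rot1 (xv k)).2 _; rewrite /=; ring.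
Qed.

End RotationGenerator.

Lemma poly_eq_horner (R : numDomainType) (p q : {poly R}) :
  (forall x, p.[x] = q.[x]) -> p = q.
Proof.
move=> pq; apply/eqP; rewrite -subr_eq0; apply: contraT => pq0.
have := max_poly_roots pq0 (rs := [seq k%:R | k <- iota 0 (size (p - q))]).
rewrite size_map size_iota ltnn; apply => //.
- by apply/allP => _ /mapP[k _ ->]; rewrite /root hornerD hornerN pq subrr.
- by rewrite map_inj_uniq ?iota_uniq// => a b /eqP; rewrite eqr_nat => /eqP.
Qed.

(** * The mean of a Laplacian *)

Section SphereMeanHarmonic.
Variables (R : realType) (d : nat).
Implicit Types (p q : mpoly d R) (i j k : 'I_d).
Local Notation xv i := (mpolyX R (mnm1 i)).
Local Notation Homog n := (@ishomog1 d R n mdeg).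
Local Notation L := (@smean R d).

(** Rotation invariance is differentiated at t = 0 algebraically: applying [L] to each coefficient
    in t of [rot_subst i j q] gives the polynomial (1 + t^2)^n [L q], whose linear coefficient is 0,
    whereas that coefficient is also 2 [L (rot_gen i j q)]. *)
Lemma smean_rot_gen n i j q : q \is Homog n -> L (rot_gen i j q) = 0.
Proof.
move=> hq; have [->|ij] := eqVneq i j; first by rewrite /rot_gen subrr raddf0.
have Lt t : L (rot_subst i j q).[mpolyC d t] = (1 + t ^+ 2) ^+ n * L q.
  have t1 : 1 + t ^+ 2 != 0 by rewrite gt_eqF// ltr_pwDl// sqr_ge0.
  apply: (mulfI (invr_neq0 (expf_neq0 n t1))).
  rewrite mulKf ?expf_neq0// -linearZ.
  apply: (smean_plane_rot (t := t) ij) => x.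
  by rewrite mevalZ (meval_rot_subst _ _ _ _ hq) mulKf ?expf_neq0.
have [c0 c1] := rot_subst_coef ij q.
move: (rot_subst i j q) Lt c0 c1 => r Lt c0 c1.
pose P := \poly_(k < size r) L r`_k.
have PE : P = L q *: (1 + 'X^2) ^+ n.
  apply: poly_eq_horner => t; rewrite horner_poly hornerZ horner_exp !hornerE mulrC -Lt.
  rewrite horner_coef raddf_sum/=; apply: eq_bigr => k _.
  by rewrite -rmorphXn/= [X in _ = L X]mulrC mul_mpolyC linearZ/= mulrC.
have : P`_1 = L r`_1.
  by rewrite coef_poly; case: ltnP => // rk; rewrite nth_default ?raddf0.
rewrite PE coefZ (_ : _`_1 = 0) ?mulr0 => [|].
  rewrite c1 -mpolyC_nat mul_mpolyC linearZ => /esym/eqP.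
  by rewrite mulf_eq0 pnatr_eq0 => /orP[//|/eqP].
elim: n {hq Lt PE} => [|n IH]; first by rewrite expr0 coef1.
by rewrite exprS coef1M IH mulr0 add0r coefD coef1 coefXn addr0 mul0r.
Qed.

Definition sqnorm : mpoly d R := \sum_i xv i ^+ 2.

Lemma smean_sqnorm p : L (sqnorm * p) = L p.
Proof.
apply: eq_smean => x xS; rewrite mevalM raddf_sum/=.
under eq_bigr => i _ do rewrite rmorphXn/= mevalXU expr2.
by rewrite (xS : \sum_i tnth x i * tnth x i = 1) mul1r.
Qed.

(* The quadratic Casimir identity
   sum_(i,j) M_ij (x_i d_j) = r^2 Lap - E (E + d - 2), E the Euler operator. *)
Lemma smean_laplacian n q : q \is Homog n ->
  L (laplacian q) = n%:R * (n%:R + d%:R - 2) * L q.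
Proof.
move=> hq.
have : L (\sum_i \sum_j rot_gen i j (xv i * mderiv j q)) = 0.
  rewrite smean_sum big1// => i _; rewrite smean_sum big1// => j _.
  by apply: (@smean_rot_gen n); exact: xv_mderiv_homog.
suff -> : \sum_i \sum_j rot_gen i j (xv i * mderiv j q) =
    sqnorm * laplacian q - (n%:R * (n%:R + d%:R - 2)) *: q.
  by rewrite smeanB smeanZ smean_sqnorm => /eqP; rewrite subr_eq0 => /eqP.
(* Summed over i and j, the four terms give n q, [sqnorm * laplacian q], d n q and n (n - 1) q, and
   n - d n - n (n - 1) = -n (n + d - 2). *)
have rE i j : rot_gen i j (xv i * mderiv j q) =
    (j == i)%:R * (xv i * mderiv j q) + xv i ^+ 2 * mderiv j (mderiv j q)
    - xv j * mderiv j q - xv j * (xv i * mderiv i (mderiv j q)).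
  by rewrite /rot_gen !mderivM !mderiv_xv eqxx/=; ring.
under eq_bigr => i _ do under eq_bigr => j _ do rewrite rE.
under eq_bigr => i _ do rewrite !sumrB big_split/=.
rewrite !sumrB big_split/=.
have -> : \sum_i \sum_j (j == i)%:R * (xv i * mderiv j q) = n%:R *: q.
  rewrite -(euler hq); apply: eq_bigr => i _; rewrite (bigD1 i)//= eqxx mul1r.
  by rewrite big1 ?addr0// => j /negbTE ->; rewrite mul0r.
have -> : \sum_i \sum_j xv i ^+ 2 * mderiv j (mderiv j q) = sqnorm * laplacian q.
  by rewrite /sqnorm mulr_suml; apply: eq_bigr => i _; rewrite /laplacian mulr_sumr.
have -> : \sum_(i < d) \sum_j xv j * mderiv j q = (d%:R * n%:R) *: q.
  by rewrite (euler hq) sumr_const card_ord -scaler_nat scalerA.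
have -> : \sum_i \sum_j xv j * (xv i * mderiv i (mderiv j q)) = (n%:R * (n%:R - 1)) *: q.
  rewrite exchange_big/=; under eq_bigr => j _ do rewrite -mulr_sumr (euler_mderiv _ hq) -scalerAr.
  by rewrite -scaler_sumr (euler hq) scalerA mulrC.
rewrite -!mul_mpolyC !(mpolyCM, mpolyCB, mpolyCD, mpolyC_nat, mpolyC1).
by ring.
Qed.
End SphereMeanHarmonic.

(** Clearing the denominator absorbs the special value: at [k = 0] both sides are d - 2, also in
    dimension 2. For k >= 1 the denominator d + 2k - 2 is positive. *)
Lemma gegenbauer_coefE (R : realType) (d k : nat) : (0 < d)%N ->
  gegenbauer_coef R d k.+1 * (d%:R + 2 * k%:R - 2) = d%:R + k%:R - 2.
Proof.
move=> d0; rewrite /gegenbauer_coef eqSS.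
case: eqP => [->|/eqP k0]; first by rewrite mul1r mulr0.
have -> : d%:R + 2 * k.+1%:R - 4 = d%:R + 2 * k%:R - 2 :> R by rewrite -natr1; ring.
have d1 : 1 <= d%:R :> R by rewrite ler1n.
have k1 : 1 <= k%:R :> R by rewrite ler1n lt0n.
rewrite -natr1; field.
by rewrite gt_eqF//; lra.
Qed.

(** The leading coefficient of Q_k. *)
Fixpoint gegenbauer_lead (R : realType) (d k : nat) : R :=
  if k is k'.+1 then (d%:R + 2 * k'%:R) / k%:R * gegenbauer_lead R d k' else 1.

Lemma gegenbauerS (R : realType) (d k : nat) :
  gegenbauer R d k.+2 = ((d%:R + 2 * k.+1%:R) / k.+2%:R) *:
    ('X * gegenbauer R d k.+1 - gegenbauer_coef R d k.+1 *: gegenbauer R d k).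
Proof. by []. Qed.

(** * Zonal harmonics and their reproducing property *)

Section Zonal.
Variables (R : realType) (d : nat) (y : d.-tuple R).
Hypothesis d0 : (0 < d)%N.
Hypothesis y1 : sphere y.
Implicit Types (p q : mpoly d R) (i j : 'I_d).
Local Notation xv i := (mpolyX R (mnm1 i)).
Local Notation Homog n := (@ishomog1 d R n mdeg).
Local Notation L := (@smean R d).

Definition linform : mpoly d R := \sum_i tnth y i *: xv i.
Local Notation u := linform.

Definition dirderiv p : mpoly d R := \sum_i tnth y i *: mderiv i p.
Local Notation D := dirderiv.

Let yy : \sum_i tnth y i * tnth y i = 1. Proof. exact: y1. Qed.

Lemma linform_homog : u \is Homog 1.
Proof. by apply: rpred_sum => i _; rewrite rpredZ// xv_homog. Qed.

Lemma mderiv_linform i : mderiv i u = (tnth y i)%:A.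
Proof.
rewrite /u raddf_sum (bigD1 i)//= mderivZ mderiv_xv eqxx big1 ?addr0//.
by move=> j; rewrite mderivZ mderiv_xv eq_sym => /negbTE ->; rewrite scaler0.
Qed.

Lemma laplacian_linformX n p : laplacian (u ^+ n * p) =
  (n%:R * n.-1%:R) *: (u ^+ n.-2 * p) + (2 * n%:R) *: (u ^+ n.-1 * D p)
  + u ^+ n * laplacian p.
Proof.
have dX i m : mderiv i (u ^+ m) = (m%:R * tnth y i) *: u ^+ m.-1.
  exact/mderivXn/mderiv_linform.
rewrite laplacianM; congr (_ + _ + _).
  rewrite /laplacian; under eq_bigr => i _ do rewrite dX mderivZ dX scalerA.
  rewrite -scaler_suml -scalerAl; congr (_ *: _).
  rewrite -[RHS]mulr1 -yy mulr_sumr; apply: eq_bigr => i _; ring.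
under eq_bigr => i _ do rewrite dX -scalerAl -scalerA scalerAr.
by rewrite -scaler_sumr -mulr_sumr -mpolyC_nat mul_mpolyC scalerA.
Qed.

Lemma harm_dirderiv l p : harm l p -> harm l.-1 (D p).
Proof.
move=> [hp lp]; split.
  by apply: rpred_sum => i _; rewrite rpredZ// mderiv_homog.
have lD i : laplacian (mderiv i p) = mderiv i (laplacian p).
  rewrite /laplacian raddf_sum; apply: eq_bigr => j _ /=.
  by rewrite (mderiv_comm i j) (mderiv_comm i j).
rewrite /D (big_morph _ (@laplacianD R d) (_ : laplacian 0 = 0)); last first.
  by rewrite /laplacian big1// => i _; rewrite !mderiv0.
by rewrite big1// => i _; rewrite laplacianZ lD lp mderiv0 scaler0.
Qed.

Lemma meval_dirderiv l p : p \is Homog l ->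
  meval (tnth y) (D p) = l%:R * meval (tnth y) p.
Proof.
move=> /euler/(congr1 (meval (tnth y))); rewrite mevalZ => <-.
rewrite !raddf_sum; apply: eq_bigr => i _ /=.
by rewrite mevalZ mevalM mevalXU.
Qed.

Lemma linformX_homog m l p : harm l p -> u ^+ m * p \is Homog (m + l).
Proof.
by move=> [hp _]; apply: dhomogM => //; have := dhomogMn m linform_homog; rewrite mul1n.
Qed.

(** Since p is harmonic, the Laplacian of u^m p involves only u^(m-2) p and u^(m-1) D p, where D p
    is harmonic of degree l - 1; both have mean 0 by induction. Parity forces m + 2 <= l, hence the
    factor of [smean_laplacian] is nonzero even in dimension 1. *)
Lemma smean_linformX_lt l m p : harm l p -> (m < l)%N -> ~~ odd (m + l) ->
  L (u ^+ m * p) = 0.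
Proof.
elim/ltn_ind: m => m IH in l p * => hp ml oml.
have m2 : (m.+2 <= l)%N by rewrite ltn_neqAle ml andbT;
  apply: contraNneq oml => <-; rewrite addnS oddS oddD addbb.
have := smean_laplacian (linformX_homog m hp).
rewrite laplacian_linformX hp.2 mulr0 addr0 smeanD !smeanZ.
have -> : m%:R * m.-1%:R * L (u ^+ m.-2 * p) = 0.
  case: m IH ml oml {m2} => [|[|m]] IH ml oml; rewrite ?mulr0 ?mul0r//=.
  rewrite (IH m (ltnW (ltnSn _)) l p hp) ?mulr0//; first by do 2 apply: ltnW.
  by rewrite !addSn/= negbK in oml.
have -> : 2 * m%:R * L (u ^+ m.-1 * D p) = 0.
  case: m IH ml oml m2 => [|m] IH ml oml m2; rewrite ?mulr0 ?mul0r//=.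
  rewrite (IH m (ltnSn _) l.-1 _ (harm_dirderiv hp)) ?mulr0//.
    by case: l ml {hp oml m2}.
  by case: l ml oml {hp m2} => // l _; rewrite addnS addSn/= negbK.
rewrite add0r => /esym/eqP; rewrite mulf_eq0 => /orP[|/eqP//].
have l2 : 2 <= l%:R :> R by rewrite ler_nat; lia.
have m0 : 0 <= m%:R :> R by [].
have d1 : 1 <= d%:R :> R by rewrite ler1n.
by rewrite natrD mulf_eq0 => /orP[] /eqP; lra.
Qed.

(** At m = l the term in u^(l-2) p has mean 0, and the remaining one reduces l by one through D p,
    with (D p)(y) = l p(y). The constants collected on the way are those of the leading coefficient
    of Q_l. *)
Lemma smean_linformX l p : fine (surface_measure (@sphere R d)) != 0 ->
  harm l p -> gegenbauer_lead R d l * L (u ^+ l * p) = meval (tnth y) p.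
Proof.
move=> s0; elim: l p => [|l IH] p hp.
  rewrite expr0 !mul1r.
  have -> : p = mcoeff mnm0 p *: 1.
    have [/dhomogP hp0 _] := hp.
    apply/mpolyP => m; rewrite mcoeffZ mcoeff1.
    have [->|m0] := eqVneq m mnm0; first by rewrite mulr1.
    rewrite mulr0; apply/eqP; rewrite mcoeff_eq0; apply: contra m0 => mp.
    by rewrite -mdeg_eq0; apply/eqP; exact: hp0.
  by rewrite smeanZ smean1// mevalZ meval1.
have := smean_laplacian (linformX_homog l.+1 hp).
rewrite laplacian_linformX hp.2 mulr0 addr0 smeanD !smeanZ /=.
have -> : l.+1%:R * l%:R * L (u ^+ l.-1 * p) = 0.
  case: l {IH} hp => [|l] hp; first by rewrite mulr0 mul0r.
  rewrite (smean_linformX_lt (m := l) hp) ?mulr0//=.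
  by rewrite !addnS /= negbK oddD addbb.
have := IH _ (harm_dirderiv hp); rewrite (meval_dirderiv hp.1) add0r.
move: (L (u ^+ l.+1 * p)) (L (u ^+ l * D p)) (meval _ _) (gegenbauer_lead _ _ _).
move=> A B C G GB AB.
have l0 : l.+1%:R != 0 :> R by rewrite pnatr_eq0.
have d1 : 1 <= d%:R :> R by rewrite ler1n.
have dl : d%:R + 2 * l%:R != 0 :> R by rewrite gt_eqF// ltr_pwDl ?mulr_ge0//; lra.
have BA : B = (d%:R + 2 * l%:R) * A.
  apply: (mulfI (_ : 2 * l.+1%:R != 0)); first by rewrite mulf_neq0// pnatr_eq0.
  by rewrite /= AB natrD -natr1; ring.
by apply: (mulfI l0); rewrite -GB BA; field.
Qed.

(** The Gegenbauer recurrence made homogeneous: [u] replaces the variable, and a factor [sqnorm],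
    which is 1 on the sphere, restores the degree of the lower term. *)
Fixpoint zonal_pair (k : nat) : mpoly d R * mpoly d R :=
  match k with
  | 0 => (1, d%:R *: u)
  | k'.+1 =>
      let Z := zonal_pair k' in
      (Z.2, ((d%:R + 2 * k%:R) / k.+1%:R) *:
            (u * Z.2 - gegenbauer_coef R d k *: (sqnorm R d * Z.1)))
  end.

Definition zonal k := (zonal_pair k).1.

Lemma zonalS k : zonal k.+2 = ((d%:R + 2 * k.+1%:R) / k.+2%:R) *:
  (u * zonal k.+1 - gegenbauer_coef R d k.+1 *: (sqnorm R d * zonal k)).
Proof. by []. Qed.

Lemma meval_zonal (x : d.-tuple R) k : sphere x ->
  meval (tnth x) (zonal k) = (gegenbauer R d k).[dotp x y].
Proof.
move=> xS.
have mu : meval (tnth x) u = dotp x y.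
  rewrite raddf_sum; apply: eq_bigr => i _.
  by rewrite /= mevalZ mevalXU mulrC.
have ms : meval (tnth x) (sqnorm R d) = 1.
  rewrite raddf_sum -[RHS](xS : \sum_i tnth x i * tnth x i = 1).
  by apply: eq_bigr => i _; rewrite /= rmorphXn/= mevalXU expr2.
elim/ltn_ind: k => -[|[|k]] IH.
- by rewrite meval1 hornerC.
- by rewrite mevalZ mu hornerZ hornerX.
- rewrite zonalS gegenbauerS mevalZ mevalB mevalZ !mevalM mu ms mul1r !IH//.
  by rewrite !hornerE.
Qed.

Lemma sqnorm_homog : sqnorm R d \is Homog 2.
Proof. by apply: rpred_sum => i _; have := dhomogMn 2 (xv_homog R i); rewrite mul1n. Qed.

Lemma zonal_homog k : zonal k \is Homog k.
Proof.
elim/ltn_ind: k => -[|[|k]] IH; first exact: dhomog1.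
  by rewrite rpredZ// linform_homog.
rewrite zonalS rpredZ// rpredB ?rpredZ//.
  exact: (dhomogM linform_homog (IH _ _)).
exact: (dhomogM sqnorm_homog (IH k _)).
Qed.

Lemma mderiv_sqnorm i : mderiv i (sqnorm R d) = 2%:R *: xv i.
Proof.
rewrite /sqnorm raddf_sum (bigD1 i)//= (mderivXn (y := 1)); last first.
  by rewrite mderiv_xv eqxx scale1r.
rewrite mulr1 expr1 big1 ?addr0// => j ji.
rewrite (mderivXn (y := 0)) ?mulr0 ?scale0r//.
by rewrite mderiv_xv eq_sym (negbTE ji).
Qed.

Lemma laplacian_sqnormM n p : p \is Homog n ->
  laplacian (sqnorm R d * p) =
  (2 * d%:R + 4 * n%:R) *: p + sqnorm R d * laplacian p.
Proof.
move=> hp.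
rewrite laplacianM scalerDl; congr (_ + _ + _).
  rewrite /laplacian; under eq_bigr => i _ do rewrite mderiv_sqnorm mderivZ mderiv_xv eqxx.
  by rewrite sumr_const card_ord -scaler_nat scalerA -scalerAl mulr1n mul1r mulrC.
under eq_bigr => i _ do rewrite mderiv_sqnorm -scalerAl.
rewrite -scaler_sumr (euler hp) -mpolyC_nat mul_mpolyC !scalerA; congr (_ *: _); ring.
Qed.

Lemma laplacian_linformM p : laplacian (u * p) = 2%:R *: D p + u * laplacian p.
Proof. by have := laplacian_linformX 1 p; rewrite mulr0 scale0r add0r expr0 mul1r mulr1. Qed.

Lemma dirderivM p q : D (p * q) = D p * q + p * D q.
Proof.
rewrite /D mulr_suml mulr_sumr -big_split/=; apply: eq_bigr => i _.
by rewrite mderivM scalerDr scalerAl scalerAr.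
Qed.

Lemma dirderivB p q : D (p - q) = D p - D q.
Proof. by rewrite /D -sumrB; apply: eq_bigr => i _; rewrite mderivB scalerBr. Qed.

Lemma dirderivZ c p : D (c *: p) = c *: D p.
Proof.
by rewrite /D scaler_sumr; apply: eq_bigr => i _; rewrite mderivZ !scalerA mulrC.
Qed.

Lemma dirderiv_linform : D u = 1.
Proof.
rewrite /D; under eq_bigr => i _ do rewrite mderiv_linform scalerA.
by rewrite -scaler_suml yy scale1r.
Qed.

Lemma dirderiv_sqnorm : D (sqnorm R d) = 2%:R *: u.
Proof.
rewrite /D /linform scaler_sumr; apply: eq_bigr => i _.
by rewrite mderiv_sqnorm !scalerA mulrC.
Qed.

(** The first relation gives harmonicity. Differentiating the recurrence produces
    [sqnorm * D (zonal k)], which the second relation rewrites, so both are proved together. *)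
Lemma dirderiv_zonal k :
  D (zonal k.+1) = (gegenbauer_coef R d k.+1 * (d%:R + 2 * k%:R)) *: zonal k /\
  sqnorm R d * D (zonal k) = (d%:R + 2 * k%:R - 2) *:
    (u * zonal k - (k.+1%:R / (d%:R + 2 * k%:R)) *: zonal k.+1).
Proof.
have d1 : 1 <= d%:R :> R by rewrite ler1n.
have dk m : d%:R + 2 * m%:R != 0 :> R.
  by rewrite gt_eqF// ltr_pwDl ?mulr_ge0//; lra.
have k0 m : m.+1%:R != 0 :> R by rewrite pnatr_eq0.
elim: k => [|k [IH1 IH2]].
  have dn : d%:R != 0 :> R by rewrite gt_eqF//; lra.
  rewrite mulr0 addr0 /zonal /= dirderivZ dirderiv_linform /gegenbauer_coef eqxx mul1r.
  split => //; rewrite scalerA mulfVK// scale1r mulr1 subrr scaler0 /D big1 ?mulr0// => i _.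
  by rewrite -mpolyC1 mderivC scaler0.
split.
  rewrite zonalS dirderivZ dirderivB dirderivZ !dirderivM dirderiv_linform.
  rewrite dirderiv_sqnorm IH1 IH2 -!mul_mpolyC.
  have cE := gegenbauer_coefE R k d0.
  have cE' := gegenbauer_coefE R k.+1 d0.
  set c := gegenbauer_coef R d k.+1 in cE *; set c' := gegenbauer_coef R d k.+2 in cE' *.
  set a := d%:R + 2 * k%:R.
  have aE : d%:R + 2 * k.+1%:R = a + 2 by rewrite /a -natr1; ring.
  have -> : u * (mpolyC d (c * a) * zonal k) = mpolyC d (c * a) * (u * zonal k) by ring.
  set U := u * zonal k.
  have -> : mpolyC d 2%:R * u * zonal k = mpolyC d 2 * U by rewrite /U mulrA.
  rewrite mul1r aE.
  (* Collected on u Z_k and Z_(k+1); the coefficient of u Z_k cancels. *)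
  transitivity (mpolyC d ((a + 2) / k.+2%:R) *
    (mpolyC d (c * a - c * 2 - c * (a - 2)) * U +
     mpolyC d (1 + c * (a - 2) * (k.+1%:R / a)) * zonal k.+1)).
    by rewrite !(mpolyCD, mpolyCN, mpolyCM, mpolyC1); ring.
  have -> : c * a - c * 2 - c * (a - 2) = 0 by ring.
  rewrite mpolyC0 mul0r add0r mulrA -mpolyCM; congr (mpolyC d _ * _).
  have a0 : a != 0 := dk k.
  have -> : c * (a - 2) = d%:R + k%:R - 2 by rewrite -cE /a.
  have -> : c' = (d%:R + k.+1%:R - 2) / a.
    by rewrite -cE' aE addrK mulfK.
  have /= k2 := k0 k.+1.
  have aD : d%:R = a - 2 * k%:R by rewrite /a addrK.
  rewrite aD; move: k2; rewrite -!natr1 => k2; field.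
  by rewrite a0 /= k2.
rewrite IH1 zonalS -!mul_mpolyC.
have -> : d%:R + 2 * k.+1%:R - 2 = d%:R + 2 * k%:R :> R by rewrite -natr1; ring.
set c := gegenbauer_coef R d k.+1; set a := d%:R + 2 * k%:R; set b := d%:R + 2 * k.+1%:R.
rewrite [mpolyC d (k.+2%:R / b) * _]mulrA -mpolyCM.
have -> : k.+2%:R / b * (b / k.+2%:R) = 1.
  by rewrite mulrA mulfVK ?mulfV ?k0 ?dk.
by rewrite mpolyC1 mpolyCM; ring.
Qed.

(** In the recurrence, u Z_(k+1) contributes 2 D Z_(k+1) and the [sqnorm] term contributes a
    multiple of Z_k; [dirderiv_zonal] makes them cancel. *)
Lemma laplacian_zonal k : laplacian (zonal k) = 0 /\ laplacian (zonal k.+1) = 0.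
Proof.
elim: k => [|k [IH1 IH2]].
  rewrite /zonal /=; split.
    by rewrite /laplacian big1// => i _; rewrite -mpolyC1 mderivC raddf0.
  rewrite /laplacian big1// => i _; rewrite mderivZ mderiv_linform mderivZ mderivZ.
  by rewrite -mpolyC1 mderivC !scaler0.
split => //; rewrite zonalS laplacianZ laplacianB laplacianZ laplacian_linformM.
rewrite (laplacian_sqnormM (zonal_homog k)) IH1 IH2 !mulr0 !addr0 (dirderiv_zonal k).1.
rewrite !scalerA -scalerBl (_ : _ - _ = 0) ?scale0r ?scaler0//; ring.
Qed.

Lemma harm_zonal k : harm k (zonal k).
Proof. by split; [exact: zonal_homog|exact: (laplacian_zonal k).1]. Qed.

(** Only the leading power of u in Z_k counts: under [L] each [sqnorm] becomes 1, which leaves lower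
    powers of u, and these have mean 0 against p. *)
Lemma smean_zonalM l k m p : harm l p -> (k + m <= l)%N -> ~~ odd (k + m + l) ->
  L (zonal k * (u ^+ m * p)) = gegenbauer_lead R d k * L (u ^+ (k + m) * p).
Proof.
elim/ltn_ind: k m => -[|[|k]] IH m hp kml okml.
- by rewrite /zonal /= !mul1r.
- rewrite /zonal /= -scalerAl smeanZ (_ : u * (u ^+ m * p) = u ^+ (1 + m) * p).
    by rewrite mulr0 addr0 divr1 mulr1.
  by rewrite mulrA -exprS.
rewrite zonalS -scalerAl smeanZ mulrBl smeanB -scalerAl smeanZ.
rewrite -[u * _ * _]mulrA -[sqnorm R d * _ * _]mulrA smean_sqnorm.
have -> : u * (zonal k.+1 * (u ^+ m * p)) = zonal k.+1 * (u ^+ m.+1 * p).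
  by rewrite exprS; ring.
have kmE : (k.+1 + m.+1 = k.+2 + m)%N by rewrite addnS addSn.
rewrite (IH k.+1 (ltnSn _) m.+1 hp) ?kmE//.
have kml' : (k + m < l)%N by apply: leq_trans kml; rewrite !addSn.
have okml' : ~~ odd (k + m + l) by move: okml; rewrite !addSn/= negbK.
rewrite (IH k (ltnW (ltnSn _)) m hp (ltnW kml') okml').
rewrite (smean_linformX_lt hp kml' okml') !mulr0 subr0.
exact: mulrA.
Qed.

Lemma smean_zonal l p : fine (surface_measure (@sphere R d)) != 0 ->
  harm l p -> L (zonal l * p) = meval (tnth y) p.
Proof.
move=> s0 hp; rewrite -(smean_linformX s0 hp).
have := @smean_zonalM l l 0 p hp; rewrite addn0 expr0 mul1r; apply => //.
by rewrite oddD addbb.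
Qed.

End Zonal.

(** Expand the zonal polynomial at y in the basis. By orthonormality its i-th coefficient is its
    mean against [phi i], which is the value of [phi i] at y by the reproducing property. *)
Lemma addition_formula (R : realType) (d h l : nat) (phi : 'I_h -> mpoly d R)
    (x y : d.-tuple R) :
  (0 < d)%N -> fine (surface_measure (@sphere R d)) != 0 ->
  harm_orthonormal_basis l phi -> sphere x -> sphere y ->
  \sum_i meval (tnth x) (phi i) * meval (tnth y) (phi i) =
  (gegenbauer R d l).[dotp x y].
Proof.
move=> d0 s0 [hphi ophi sphi] xS yS.
rewrite -(meval_zonal y l xS).
have [c zE] := sphi _ (harm_zonal d0 yS l).
rewrite zE raddf_sum; apply: eq_bigr => i _ /=; rewrite mevalZ mulrC; congr (_ * _).
rewrite -(smean_zonal d0 yS s0 (hphi i)) zE mulr_suml smean_sum (bigD1 i)//=.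
rewrite -scalerAl smeanZ -harm_innerE ophi eqxx mulr1 big1 ?addr0// => j ji.
by rewrite -scalerAl smeanZ -harm_innerE ophi (negbTE ji) mulr0.
Qed.

(** An orthonormal basis in degree 0 already forces this: it is nonempty because 1 is harmonic,
    while a zero mass would make [harm_inner] vanish identically. *)
Lemma surface_sphere_neq0 (R : realType) (d h : nat) (phi : 'I_h -> mpoly d R) :
  harm_orthonormal_basis 0 phi -> fine (surface_measure (@sphere R d)) != 0.
Proof.
move=> [_ ophi sphi].
have h1 : harm 0 (1 : mpoly d R).
  split; first exact: dhomog1.
  by rewrite /laplacian big1// => i _; rewrite -mpolyC1 mderivC raddf0.
have [c oneE] := sphi _ h1; apply/eqP => s0.
have ip p q : @harm_inner R d p q = 0 by rewrite /harm_inner s0 invr0 mul0r.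
case: h phi ophi c oneE {sphi} => [|h] phi ophi c oneE.
  by move/eqP: oneE; rewrite big_ord0 oner_eq0.
by have /eqP := ophi ord0 ord0; rewrite ip eqxx eq_sym oner_eq0.
Qed.

(** * The filtration by degree and its idempotents *)

Section SymmetricMatrixAlgebra.
Variables (R : realFieldType) (n : nat).
Implicit Types M N : 'M[R]_n.

Lemma trmx_mul_eq0 m (M : 'M[R]_(m, n)) : M^T *m M = 0 -> M = 0.
Proof.
move=> MM; apply/matrixP => i j; have /matrixP/(_ j j) := MM.
rewrite !mxE; under eq_bigr => k _ do rewrite mxE -expr2.
move/eqP; rewrite psumr_eq0 => [/allP/(_ i)|k _]; last exact: sqr_ge0.
by rewrite mem_index_enum sqrf_eq0 => /(_ isT)/eqP.
Qed.

Lemma sym_sqr_mul_eq0 M N : M^T = M -> M *m (M *m N) = 0 -> M *m N = 0.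
Proof. by move=> Ms MMN; apply: trmx_mul_eq0; rewrite trmx_mul Ms -mulmxA MMN mulmx0. Qed.

Variables (s w : nat) (F : nat -> 'M[R]_n) (A : {vspace 'M[R]_n}).
Hypothesis Fsym : forall k, (F k)^T = F k.
Hypothesis Asym : forall M, M \in A -> M^T = M.
Hypothesis A1 : 1%:M \in A.
Hypothesis AF : forall k, (k <= w + s)%N -> F k \in A.
Hypothesis Adim : (\dim A <= s.+1)%N.
Hypothesis Forth : forall k l, (l <= w + s)%N -> (k + w < l)%N -> F k *m F l = 0.
Hypothesis Fneq0 : forall k, (k <= s)%N -> F k *m F (w + k) != 0.

(** The family F_0, ..., F_(k-1), I, F_(w+k+1), ..., F_(w+s). For [k = s.+1] the identity does not
    occur and the family is F_0, ..., F_s. *)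
Definition mixed_family k i : 'M[R]_n :=
  if (i < k)%N then F i else if i == k then 1%:M else F (w + i).

Lemma mixed_family_free k (x : nat -> R) :
  \sum_(i < s.+1) x i *: mixed_family k i = 0 -> forall i, (i <= s)%N -> x i = 0.
Proof.
move=> sum0.
have scale0 i y : (i <= s)%N -> y *: (F i *m F (w + i)) = 0 -> y = 0.
  by move=> si /eqP; rewrite scaler_eq0 (negbTE (Fneq0 si)) orbF => /eqP.
(* Between F_k and F_(w+k) only the identity survives: F_(w+k) kills the F_i with i < k, and F_k
   kills the F_(w+i) with i > k. *)
have xk : (k <= s)%N -> x k = 0.
  move=> ks; have ks' : (k < s.+1)%N by [].
  apply: (scale0 k) => //.
  have := congr1 (fun M => F k *m M *m F (w + k)) sum0.
  rewrite mulmx0 mul0mx mulmx_sumr mulmx_suml (bigD1 (Ordinal ks'))//= big1.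
    by rewrite /mixed_family ltnn eqxx -scalemxAr mulmx1 -scalemxAl addr0.
  move=> i; rewrite -val_eqE/= => ik; rewrite -scalemxAr -scalemxAl /mixed_family (negbTE ik).
  have is_ : (i <= s)%N by rewrite -ltnS.
  case: ltngtP ik => // ik _.
    by rewrite -mulmxA (Forth (k := i)) ?mulmx0 ?scaler0//; lia.
  by rewrite Forth ?mul0mx ?scaler0//; lia.
(* Indices below k are treated downwards, [m] bounding k - i. What survives is F_i F_i F_(w+i),
   nonzero because F_i is symmetric. *)
have xlt m i : (i <= s)%N -> (i < k)%N -> (k <= i + m)%N -> x i = 0.
  elim: m i => [|m IH] i si ik kim; first by lia.
  have si' : (i < s.+1)%N by [].
  apply: (scale0 i) => //; rewrite scalemxAr; apply: sym_sqr_mul_eq0 => //.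
  have := congr1 (fun M => F i *m M *m F (w + i)) sum0.
  rewrite mulmx0 mul0mx mulmx_sumr mulmx_suml (bigD1 (Ordinal si'))//= big1.
    by rewrite /mixed_family ik -!scalemxAr -scalemxAl addr0 -mulmxA.
  move=> j; rewrite -val_eqE/= => ji; have sj : (j <= s)%N by rewrite -ltnS.
  rewrite -scalemxAr -scalemxAl /mixed_family; case: (ltngtP j k) => jk.
  - case: (ltngtP j i) ji => // ji _; last by rewrite (IH j) ?scale0r//; lia.
    by rewrite -mulmxA (Forth (k := j)) ?mulmx0 ?scaler0//; lia.
  - by rewrite Forth ?mul0mx ?scaler0//; lia.
  - by rewrite jk xk ?scale0r// -jk.
(* Indices above k are treated upwards: F_i kills F_(w+j) for j > i, and the coefficients before i
   are already 0. *)
have xgt i : (i <= s)%N -> (k < i)%N -> x i = 0.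
  elim/ltn_ind: i => i IH si ki; have si' : (i < s.+1)%N by [].
  apply: (scale0 i) => //.
  have := congr1 (fun M => F i *m M) sum0.
  rewrite mulmx0 mulmx_sumr (bigD1 (Ordinal si'))//= big1.
    by rewrite /mixed_family ltnNge (ltnW ki) gtn_eqF//= -scalemxAr addr0.
  move=> j; rewrite -val_eqE/= => ji; have sj : (j <= s)%N by rewrite -ltnS.
  rewrite -scalemxAr /mixed_family; case: (ltngtP j k) => jk.
  - by rewrite (xlt k j)// ?scale0r//; lia.
  - case: (ltngtP j i) ji => // ji _; first by rewrite (IH j) ?scale0r.
    by rewrite Forth ?scaler0//; lia.
  - by rewrite jk xk ?scale0r// -jk.
move=> i si; case: (ltngtP i k) => ik; last by rewrite ik xk// -ik.
  by apply: (xlt k i) => //; lia.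
exact: xgt.
Qed.

Lemma mixed_family_span k N : (k <= s.+1)%N -> N \in A ->
  exists x : nat -> R, N = \sum_(i < s.+1) x i *: mixed_family k i.
Proof.
move=> ks NA; pose X := [tuple mixed_family k i | i < s.+1].
have XE (i : 'I_s.+1) : X`_i = mixed_family k i.
  by rewrite (nth_map i) ?size_enum_ord// nth_ord_enum.
have fX : free X.
  apply/freeP => c c0 i.
  have := @mixed_family_free k (fun j => c (inord j)).
  under eq_bigr => j _ do rewrite inord_val -XE.
  by move=> /(_ c0 i); rewrite inord_val; apply; rewrite -ltnS.
have XA : (<<X>> <= A)%VS.
  apply/span_subvP => _ /mapP[i _ ->]; rewrite /mixed_family.
  have si := ltn_ord i.
  by case: ifP => ik; [|case: eqP => // _]; apply: AF; lia.
have bX : basis_of A X by rewrite basisEfree fX XA size_tuple.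
exists (fun j => coord X (inord j) N).
rewrite [LHS](coord_basis bX NA); apply: eq_bigr => i _.
by rewrite inord_val XE.
Qed.

Definition filtration m : {vspace 'M[R]_n} := <<mkseq F m>>%VS.

Lemma filtrationS m : filtration m.+1 = (filtration m + <[F m]>)%VS.
Proof. by rewrite /filtration -addn1 /mkseq iotaD map_cat span_cat/= span_seq1. Qed.

Lemma mem_filtration i m : (i < m)%N -> F i \in filtration m.
Proof. by move=> im; apply/memv_span/map_f; rewrite mem_iota. Qed.

Lemma filtration_sub i m : (i <= m)%N -> (filtration i <= filtration m)%VS.
Proof.
move=> im; apply/span_subvP => _ /mapP[j + ->]; rewrite mem_iota/= => ji.
by apply: mem_filtration; apply: leq_trans im.
Qed.

Lemma filtration_subA m : (m <= s.+1)%N -> (filtration m <= A)%VS.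
Proof.
move=> ms; apply/span_subvP => _ /mapP[j + ->]; rewrite mem_iota/= => jm.
by apply: AF; lia.
Qed.

(** Expand N in the mixed basis at k: the tail is killed by F_k and the identity gives F_k. For i <
    k, induction puts F_i F_k in [filtration i.+1], hence it is symmetric and equals F_k F_i.
    Commutativity of [A] is thus not presupposed but follows. *)
Lemma mulF_filtration k N : (k <= s)%N -> N \in A -> F k *m N \in filtration k.+1.
Proof.
elim/ltn_ind: k N => k IH N ks NA.
have FkA : F k \in A by apply: AF; lia.
have [x ->] := mixed_family_span (leqW ks) NA.
rewrite mulmx_sumr; apply: rpred_sum => i _; rewrite -scalemxAr rpredZ//.
have si : (i <= s)%N by rewrite -ltnS.
rewrite /mixed_family; case: ltngtP => ik.
- have FF := IH i ik (F k) si FkA.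
  have := Asym (subvP (filtration_subA (ltn_ord i)) _ FF).
  rewrite trmx_mul !Fsym => ->.
  by apply: subvP FF; apply: filtration_sub; rewrite ltnW.
- by rewrite Forth ?mem0v//; lia.
- by rewrite mulmx1 mem_filtration.
Qed.

Lemma mulA_closed M N : M \in A -> N \in A -> M *m N \in A.
Proof.
move=> MA NA; have [x ->] := mixed_family_span (leqnn _) MA.
rewrite mulmx_suml; apply: rpred_sum => i _; rewrite -scalemxAl rpredZ//.
rewrite /mixed_family ltn_ord; have si : (i <= s)%N by rewrite -ltnS.
exact: subvP (filtration_subA (ltn_ord i)) _ (mulF_filtration si NA).
Qed.

Lemma mulA_comm M N : M \in A -> N \in A -> M *m N = N *m M.
Proof.
move=> MA NA; have := Asym (mulA_closed MA NA).
by rewrite trmx_mul (Asym MA) (Asym NA).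
Qed.

Lemma mul_filtration m M N : (m <= s.+1)%N -> M \in filtration m -> N \in A ->
  M *m N \in filtration m.
Proof.
move=> ms /coord_span-> NA; rewrite mulmx_suml; apply: rpred_sum => i _.
rewrite -scalemxAl rpredZ//.
have im : (i < m)%N := ltn_ord i.
rewrite nth_mkseq//; apply: subvP (filtration_sub im) _ _.
by apply: mulF_filtration => //; lia.
Qed.

(** Right multiplication by F_(w+k) kills F_0, ..., F_(k-1) but not F_k. *)
Lemma F_notin_filtration k : (k <= s)%N -> F k \notin filtration k.
Proof.
move=> ks; apply: contra (Fneq0 ks) => /coord_span ->.
rewrite mulmx_suml big1// => i _; have ik : (i < k)%N := ltn_ord i.
by rewrite -scalemxAl nth_mkseq// Forth ?scaler0//; lia.
Qed.

Definition idempotent_system m (E : nat -> 'M[R]_n) :=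
  [/\ forall i, (i < m)%N -> E i \in filtration i.+1,
      forall i, (i < m)%N -> exists2 x, x != 0 & E i - x *: F i \in filtration i,
      forall i j, (i < m)%N -> (j < m)%N -> E i *m E j = (i == j)%:R *: E i,
      forall i, (i < m)%N -> E i != 0 &
      (filtration m <= <<mkseq E m>>)%VS].

(* With P the sum of the idempotents already found, P is the identity of the
   ideal filtration m, so F m (1 - P) spans a complement of filtration m in
   filtration m.+1 annihilated by filtration m. *)
Lemma idempotent_system_exists m : (m <= s.+1)%N -> exists E, idempotent_system m E.
Proof.
elim: m => [|m IH] ms; first by exists F; split => //; exact: subvv.
have [E [Efil Elead Eorth Eneq0 Espan]] := IH (ltnW ms).
pose P := \sum_(i < m) E i.
have EA i : (i < m)%N -> E i \in A.
  by move=> im; apply: subvP (filtration_subA _) _ (Efil i im); lia.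
have Efm i : (i < m)%N -> E i \in filtration m.
  by move=> im; apply: subvP (filtration_sub im) _ (Efil i im).
have Pfm : P \in filtration m by apply: rpred_sum => i _; exact: Efm.
have PA : P \in A by apply: subvP (filtration_subA (ltnW ms)) _ Pfm.
have FmA : F m \in A by apply: AF; lia.
have EP i : (i < m)%N -> E i *m P = E i.
  move=> im; rewrite mulmx_sumr (bigD1 (Ordinal im))//= big1 ?addr0.
    by rewrite Eorth// eqxx scale1r.
  by move=> j; rewrite -val_eqE/= => ji; rewrite Eorth// eq_sym (negbTE ji) scale0r.
have fP M : M \in filtration m -> M *m P = M.
  move=> /(subvP Espan)/coord_span ->; rewrite mulmx_suml; apply: eq_bigr => i _.
  have im : (i < m)%N := ltn_ord i.
  by rewrite -scalemxAl nth_mkseq// EP.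
pose W := F m - F m *m P.
have FPf : F m *m P \in filtration m.
  by rewrite mulA_comm//; apply: mul_filtration => //; exact: ltnW.
have Wf : W \in filtration m.+1.
  by rewrite rpredB ?mem_filtration//; apply: subvP (filtration_sub (leqnSn _)) _ FPf.
have WA : W \in A by apply: subvP (filtration_subA ms) _ Wf.
have WP : W *m P = 0 by rewrite mulmxBl (fP _ FPf) subrr.
have WE i : (i < m)%N -> W *m E i = 0.
  by move=> im; rewrite -(EP i im) (mulA_comm (EA _ im) PA) mulmxA WP mul0mx.
have W0 : W != 0.
  apply: contraNneq (F_notin_filtration ms) => /eqP.
  by rewrite subr_eq0 => /eqP ->.
(* Write W W = a + x F_m with a in [filtration m]. Multiplying by 1 - P kills a, turns F_m into W,
   and fixes W W. *)
have [x WW] : exists x, W *m W = x *: W.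
  have := mul_filtration ms Wf WA; rewrite filtrationS => /memv_addP[a af [_ /vlineP[x ->] WWE]].
  exists x; have : W *m W = W *m W - W *m W *m P by rewrite -mulmxA WP mulmx0 subr0.
  by rewrite WWE mulmxDl (fP a)// -scalemxAl opprD addrACA subrr add0r -scalerBr.
(* A nonzero symmetric matrix has nonzero square, so W can be rescaled to an idempotent. *)
have x0 : x != 0.
  apply: contraNneq W0 => x0; rewrite -[W]mulmx1.
  by apply/eqP/sym_sqr_mul_eq0; rewrite ?(Asym WA)// mulmx1 WW x0 scale0r.
pose E' i := if i == m then x^-1 *: W else E i.
have E'm : E' m = x^-1 *: W by rewrite /E' eqxx.
have E'lt i : (i < m)%N -> E' i = E i by move=> im; rewrite /E' ltn_eqF.
have cs i : (i < m.+1)%N -> (i == m) || (i < m)%N by rewrite ltnS leq_eqVlt.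
exists E'; split.
- move=> i /cs/orP[/eqP->|im]; first by rewrite E'm rpredZ.
  by rewrite E'lt// Efil.
- move=> i /cs/orP[/eqP->|im]; last by rewrite E'lt//; exact: Elead.
  exists x^-1; first by rewrite invr_eq0.
  by rewrite E'm -scalerBr rpredZ// /W addrAC subrr add0r rpredN.
- move=> i j /cs/orP[/eqP->|im] /cs/orP[/eqP->|jm].
  + by rewrite eqxx scale1r E'm -scalemxAl -scalemxAr WW !scalerA mulfVK.
  + by rewrite E'm E'lt// -scalemxAl WE// gtn_eqF// scaler0 scale0r.
  + by rewrite E'm E'lt// -scalemxAr (mulA_comm (EA _ im) WA) WE// ltn_eqF// scaler0 scale0r.
  + by rewrite !E'lt// Eorth.
- move=> i /cs/orP[/eqP->|im]; last by rewrite E'lt// Eneq0.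
  by rewrite E'm scaler_eq0 invr_eq0 negb_or x0.
- have sE : (filtration m <= <<mkseq E' m.+1>>)%VS.
    apply: subv_trans Espan _; apply/span_subvP => _ /mapP[i + ->].
    rewrite mem_iota/= => im; rewrite -E'lt//; apply/memv_span/map_f.
    by rewrite mem_iota/= ltnS ltnW.
  rewrite filtrationS subv_add sE -memvE.
  have -> : F m = x *: E' m + F m *m P by rewrite E'm scalerA mulfV// scale1r subrK.
  apply: rpredD; last exact: (subvP sE).
  apply: rpredZ; apply/memv_span/map_f.
  by rewrite mem_iota/=.
Qed.
End SymmetricMatrixAlgebra.

(** * Gram matrices *)

Lemma size_gegenbauer (R : realType) (d k : nat) : (0 < d)%N ->
  size (gegenbauer R d k) = k.+1.
Proof.
move=> d0; have d1 : 1 <= d%:R :> R by rewrite ler1n.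
elim/ltn_ind: k => -[|[|k]] IH; first exact: size_poly1.
  by rewrite /gegenbauer /= size_scale ?size_polyX// gt_eqF//; lra.
rewrite gegenbauerS size_scale; last first.
  by rewrite mulf_neq0 ?invr_eq0 ?pnatr_eq0// gt_eqF// ltr_pwDl ?mulr_ge0//; lra.
have Qk0 : gegenbauer R d k.+1 != 0 by rewrite -size_poly_gt0 IH.
rewrite size_polyDl; first by rewrite mulrC size_mulX// IH.
rewrite size_polyN mulrC size_mulX// IH//.
by apply: leq_ltn_trans (size_scale_leq _ _) _; rewrite IH.
Qed.

Lemma gegenbauer_recurrence (R : realType) (d k : nat) (x : R) : (0 < d)%N ->
  x * (gegenbauer R d k.+1).[x] =
  (k.+2%:R / (d%:R + 2 * k.+1%:R)) * (gegenbauer R d k.+2).[x]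
  + gegenbauer_coef R d k.+1 * (gegenbauer R d k).[x].
Proof.
move=> d0; have d1 : 1 <= d%:R :> R by rewrite ler1n.
have dk : d%:R + 2 * k.+1%:R != 0 :> R.
  by rewrite gt_eqF// ltr_pwDl ?mulr_ge0//; lra.
have k0 : k.+2%:R != 0 :> R by rewrite pnatr_eq0.
rewrite gegenbauerS hornerZ mulrA (_ : _ / _ * (_ / _) = 1); last first.
  by rewrite mulrA mulfVK ?mulfV.
by rewrite mul1r hornerD hornerN hornerZ hornerM hornerX subrK.
Qed.

Lemma gegenbauer_recurrence0 (R : realType) (d : nat) (x : R) : (0 < d)%N ->
  x * (gegenbauer R d 0).[x] = d%:R^-1 * (gegenbauer R d 1).[x].
Proof.
move=> d0; rewrite /gegenbauer/= hornerC hornerZ hornerX mulr1 mulKf//.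
by rewrite pnatr_eq0 -lt0n.
Qed.

Lemma gegenbauer_coef_gt0 (R : realType) (d k : nat) : (0 < d)%N ->
  ~~ ((d == 1%N) && (k == 1%N)) -> 0 < gegenbauer_coef R d k.+1.
Proof.
move=> d0 dk; rewrite /gegenbauer_coef eqSS; case: eqP => [//|/eqP k0].
have d1 : 1 <= d%:R :> R by rewrite ler1n.
have k1 : 1 <= k%:R :> R by rewrite ler1n lt0n.
have dk3 : 3 <= d%:R + k%:R :> R by rewrite -natrD ler_nat; lia.
by rewrite -natr1 divr_gt0//; lra.
Qed.

(* The traces T k l of the products F_k F_l satisfy T k (w + k) > 0: evaluate
   the sum of g Q_k(g) Q_(w+k+1)(g) over all inner products g by the three-term
   recurrence of Q_k and by that of Q_(w+k+1), and use T >= 0. *)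
Lemma trace_recurrence_gt0 (R : realType) (d s w : nat) (I : finType) (g : I -> R)
    (T := fun k l => \sum_i (gegenbauer R d k).[g i] * (gegenbauer R d l).[g i]) :
  (0 < d)%N -> (d = 1%N -> (s <= 1)%N /\ (s = 1%N -> w <> 1%N)) ->
  (forall k l, 0 <= T k l) -> 0 < T 0%N w ->
  (forall k l, (l <= w + s)%N -> (k + w < l)%N -> T k l = 0) ->
  forall k, (k <= s)%N -> 0 < T k (w + k)%N.
Proof.
move=> d0 d1 T0 Tw Torth; elim=> [|k IH] ks; first by rewrite addn0.
have dpos m : 0 < d%:R + 2 * m%:R :> R.
  by rewrite ltr_pwDl ?mulr_ge0// ltr0n.
pose S := \sum_i g i * (gegenbauer R d k).[g i] * (gegenbauer R d (w + k).+1).[g i].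
(* The lower term of the recurrence of Q_k leads to T (k-1) (w+k+1), whose indices differ by more
   than w. *)
have S1 : S = (k.+1%:R / (d%:R + 2 * k%:R)) * T k.+1 (w + k).+1.
  have TS m c (P : R -> R) :
      (forall x, x * (gegenbauer R d k).[x] = c * (gegenbauer R d k.+1).[x] + P x) ->
      \sum_i P (g i) * (gegenbauer R d m).[g i] = 0 ->
      \sum_i g i * (gegenbauer R d k).[g i] * (gegenbauer R d m).[g i] = c * T k.+1 m.
    move=> recE P0; rewrite -[RHS]addr0 -[X in _ + X]P0 /T mulr_sumr -big_split/=.
    by apply: eq_bigr => i _; rewrite recE mulrDl mulrA.
  rewrite /S; case: k {S} TS ks {IH} => [|k] TS ks.
    apply: (TS _ _ (fun _ => 0)) => [x|]; last by rewrite big1// => i _; rewrite mul0r.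
    by rewrite gegenbauer_recurrence0// mulr0 !addr0 div1r.
  apply: (TS _ _ (fun x => gegenbauer_coef R d k.+1 * (gegenbauer R d k).[x])).
    by move=> x; rewrite gegenbauer_recurrence.
  under eq_bigr => i _ do rewrite -mulrA.
  by rewrite -mulr_sumr -/(T _ _) Torth ?mulr0//; lia.
have S2 : S = ((w + k).+2%:R / (d%:R + 2 * (w + k).+1%:R)) * T k (w + k).+2
    + gegenbauer_coef R d (w + k).+1 * T k (w + k)%N.
  rewrite /S /T !mulr_sumr -big_split/=; apply: eq_bigr => i _.
  by rewrite mulrAC gegenbauer_recurrence// mulrDl -!mulrA ![_.[_] * (gegenbauer R d k).[_]]mulrC.
have : 0 < S.
  rewrite S2 ltr_wpDl//; first by rewrite mulr_ge0// divr_ge0// ltW.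
  rewrite mulr_gt0 ?gegenbauer_coef_gt0//; last by apply: IH; lia.
  (* The coefficient of index w + k + 1 vanishes only for d = 1 and w + k = 1. Then k = 0, s = 1 and
     w = 1, which [d1] excludes. *)
  apply/negP => /andP[/eqP/d1[s1 sw] /eqP wk]; have : s = 1%N by lia.
  by move/sw; lia.
by rewrite S1 addnS pmulr_rgt0// divr_gt0// ltr0n.
Qed.

Lemma span_mkseqP (K : fieldType) (vT : vectType K) m (v : nat -> vT) x :
  x \in <<mkseq v m>>%VS -> exists c : 'I_m -> K, x = \sum_i c i *: v i.
Proof.
have -> : mkseq v m = [tuple v i | i < m] by rewrite /= /mkseq -val_enum_ord -map_comp.
move=> /coord_span xE; exists (fun i => coord [tuple v i | i < m] i x).
by rewrite [LHS]xE; apply: eq_bigr => i _; rewrite (nth_map i) ?size_enum_ord ?nth_ord_enum.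
Qed.

(** * The scheme and its idempotents as functions of the Gram matrix *)

Section GramScheme.
Variables (R : realType) (T : finType) (s : nat) (a : s.+1.-tuple R) (g : T -> T -> R).
Hypothesis a_uniq : uniq a.
Hypothesis g_in : forall x y, g x y \in val a.
Hypothesis gC : forall x y, g x y = g y x.
Local Notation N := #|T|.

Definition gram_rel (i : 'I_s.+1) : rel T := fun x y => g x y == tnth a i.

Definition gram_mx (f : R -> R) : 'M[R]_N :=
  \matrix_(i, j) f (g (enum_val i) (enum_val j)).

Local Notation A := (bose_mesner R gram_rel).

Lemma bose_mesnerP M : M \in A <-> exists f, M = gram_mx f.
Proof.
split=> [/memv_sumP[v vA ->]|[f ->]].
  have /fin_all_exists[c vE] : forall i, exists k, v i = k *: adjacency R gram_rel i.
    by move=> i; have /vlineP := vA i isT.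
  exists (fun t => \sum_i c i * (t == tnth a i)%:R); apply/matrixP => x y.
  by rewrite summxE mxE; apply: eq_bigr => i _; rewrite vE !mxE.
rewrite (_ : gram_mx f = \sum_i f (tnth a i) *: adjacency R gram_rel i).
  by apply: memv_sumr => i _; rewrite memvZ// memv_line.
apply/matrixP => x y; rewrite summxE mxE.
have /tnthP[k gk] := g_in (enum_val x) (enum_val y).
rewrite (bigD1 k)//= !mxE /gram_rel gk eqxx mulr1 big1 ?addr0// => i ik.
rewrite !mxE (_ : _ == _ = false) ?mulr0//; apply: contraNF ik => /eqP.
by rewrite gk => /(tuple_uniqP _ a_uniq) ->.
Qed.

Lemma gram_mx_sym f : (gram_mx f)^T = gram_mx f.
Proof. by apply/matrixP => x y; rewrite !mxE gC. Qed.

Lemma dim_bose_mesner : (\dim A <= s.+1)%N.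
Proof.
apply: leq_trans (dimv_leq_sum _ _ _) _.
apply: (@leq_trans (\sum_(i < s.+1) 1)); last by rewrite sum1_card card_ord.
by apply: leq_sum => i _; rewrite dim_vline leq_b1.
Qed.

Variables (w : nat) (F : nat -> 'M[R]_N) (q : nat -> {poly R}).
Hypothesis gram0 : forall x y, gram_rel ord0 x y = (x == y).
Hypothesis gram_ex : forall i, exists x y, gram_rel i x y.
Hypothesis FE : forall k, F k = gram_mx (horner (q k)).
Hypothesis size_q : forall k, size (q k) = k.+1.
Hypothesis Forth : forall k l, (l <= w + s)%N -> (k + w < l)%N -> F k *m F l = 0.
Hypothesis Fneq0 : forall k, (k <= s)%N -> F k *m F (w + k) != 0.

Let Fsym k : (F k)^T = F k. Proof. by rewrite FE gram_mx_sym. Qed.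

Let Asym M : M \in A -> M^T = M.
Proof. by move=> /bose_mesnerP[f ->]; exact: gram_mx_sym. Qed.

Let A1 : 1%:M \in A.
Proof.
apply/bose_mesnerP; exists (fun t => (t == tnth a ord0)%:R); apply/matrixP => x y.
by rewrite !mxE -[_ == tnth _ _]/(gram_rel ord0 _ _) gram0 (inj_eq enum_val_inj).
Qed.

Let AF k : (k <= w + s)%N -> F k \in A.
Proof. by move=> _; apply/bose_mesnerP; exists (horner (q k)). Qed.

Let mulA M M' : M \in A -> M' \in A -> M *m M' \in A.
Proof. exact: (mulA_closed Fsym Asym A1 AF dim_bose_mesner Forth Fneq0). Qed.

Lemma gram_association_scheme : association_scheme gram_rel.
Proof.
split=> //.
- split => // x y; have /tnthP[i gi] := g_in x y.
  exists i; split; first by rewrite /gram_rel gi.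
  by move=> j /eqP; rewrite gi => /(tuple_uniqP _ a_uniq).
- by move=> i x y; rewrite /gram_rel gC.
pose cnt i j x y := #|[pred z | gram_rel i x z && gram_rel j z y]|.
(* Each intersection number is read off at one chosen pair of relation k. The choice is harmless:
   A_i A_j lies in [A], so its entries depend only on the inner product. *)
exists (fun i j k => if [pick xy | gram_rel k xy.1 xy.2] is Some xy
  then cnt i j xy.1 xy.2 else 0%N) => i j k x y kxy.
have AA l : adjacency R gram_rel l \in A.
  by apply: (subvP (sumv_sup l _ (subvv _))) => //; exact: memv_line.
have cntE x' y' : (adjacency R gram_rel i *m adjacency R gram_rel j)
    (enum_rank x') (enum_rank y') = (cnt i j x' y')%:R.
  rewrite mxE (reindex enum_rank)/=; last exact/onW_bij/enum_rank_bij.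
  transitivity (\sum_z (gram_rel i x' z && gram_rel j z y')%:R : R).
    by apply: eq_bigr => z _; rewrite !mxE !enum_rankK -natrM mulnb.
  rewrite -natr_sum; congr (_%:R); rewrite /cnt -sum1_card [RHS]big_mkcond/=.
  by apply: eq_bigr => z _; rewrite inE; case: (_ && _).
have [f fE] := (bose_mesnerP _).1 (mulA (AA i) (AA j)).
case: pickP => [[x' y'] /= kxy'|/(_ (x, y))]; last by rewrite /= kxy.
apply/eqP; rewrite -(eqr_nat R) -/(cnt i j x y) -!cntE fE !mxE !enum_rankK.
by rewrite (eqP kxy) (eqP kxy').
Qed.

Lemma filtration_gram m M : M \in filtration F m ->
  exists2 p : {poly R}, (size p <= m)%N & M = gram_mx (horner p).
Proof.
elim: m M => [|m IH] M.
  rewrite /filtration span_nil memv0 => /eqP ->; exists 0; first by rewrite size_poly0.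
  by apply/matrixP => x y; rewrite !mxE horner0.
rewrite filtrationS => /memv_addP[N' /IH[p sp ->] [_ /vlineP[c ->] ->]].
exists (p + c *: q m).
  rewrite (leq_trans (size_polyD _ _))// geq_max (leqW sp).
  by rewrite (leq_trans (size_scale_leq _ _))// size_q.
by apply/matrixP => x y; rewrite FE !mxE hornerD hornerZ.
Qed.

Lemma gram_Q_polynomial : Q_polynomial R gram_rel.
Proof.
have [E [Efil Elead Eorth Eneq0 Espan]] :=
  idempotent_system_exists Fsym Asym A1 AF dim_bose_mesner Forth Fneq0 (leqnn _).
have EA i : (i < s.+1)%N -> E i \in A.
  move=> si; have [p _ ->] := filtration_gram (Efil i si).
  by apply/bose_mesnerP; exists (horner p).
have AE M : M \in A -> exists c : 'I_s.+1 -> R, M = \sum_i c i *: E i.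
  move=> MA.
  have [x ->] := mixed_family_span Fsym A1 AF dim_bose_mesner Forth Fneq0 (leqnn _) MA.
  have : \sum_(i < s.+1) x i *: mixed_family w F s.+1 i \in <<mkseq E s.+1>>%VS.
    apply: (subvP Espan); apply: rpred_sum => i _; rewrite rpredZ//.
    by rewrite /mixed_family ltn_ord mem_filtration.
  exact: span_mkseqP.
have ME (c : 'I_s.+1 -> R) (i : 'I_s.+1) : (\sum_j c j *: E j) *m E i = c i *: E i.
  rewrite mulmx_suml (bigD1 i)//= -scalemxAl Eorth// eqxx scale1r big1 ?addr0// => j ji.
  by rewrite -scalemxAl Eorth// val_eqE (negbTE ji) scale0r scaler0.
have idem M : bm_idempotent gram_rel M -> forall i : 'I_s.+1, M *m E i = 0 \/ M *m E i = E i.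
  move=> [/AE[c ->] MM] i; rewrite ME.
  have : (c i ^+ 2 - c i) *: E i = 0.
    have := congr1 (mulmx^~ (E i)) MM.
    rewrite /= -mulmxA ME -scalemxAr ME scalerA => ccE.
    by rewrite scalerBl expr2 ccE subrr.
  move/eqP; rewrite scaler_eq0 (negbTE (Eneq0 i (ltn_ord i))) orbF.
  rewrite expr2 -{3}[c i]mulr1 -mulrBr mulf_eq0 subr_eq0.
  by move=> /orP[] /eqP ->; [left; rewrite scale0r|right; rewrite scale1r].
have comm M (i : 'I_s.+1) : M \in A -> E i *m M = M *m E i.
  by move=> MA; apply: (mulA_comm Fsym Asym A1 AF dim_bose_mesner Forth Fneq0) => //; exact: EA.
have Eidem (i : 'I_s.+1) : E i *m E i = E i by rewrite Eorth// eqxx scale1r.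
have N0 : N%:R != 0 :> R.
  have [x _] := gram_ex ord0; rewrite pnatr_eq0 -lt0n; apply/card_gt0P.
  by exists x.
(* E_i is a nonzero multiple of F_i plus terms of lower degree, so the degree is exactly i. *)
have lead (i : 'I_s.+1) : exists2 p : {poly R}, size p = i.+1 &
    N%:R *: E i = gram_mx (horner p).
  have [x x0 /filtration_gram[p sp Ep]] := Elead i (ltn_ord i).
  exists (N%:R *: (x *: q i + p)).
    by rewrite size_scale// size_polyDl size_scale// size_q// ltnS.
  rewrite -[E i](subrK (x *: F i)) Ep FE; apply/matrixP => u v.
  by rewrite !mxE !hornerE addrC.
(* A polynomial of degree 0 gives a multiple of the all-ones matrix J; idempotence and J J = |T| J
   fix the factor. *)
have E0 : E 0%N = N%:R^-1 *: const_mx 1.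
  have [p /eqP/size_poly1P[c c0 pE] NE] := lead ord0.
  have E0 : E 0%N = (N%:R^-1 * c) *: const_mx 1.
    apply: (scalerI N0); rewrite [LHS]NE scalerA mulrA mulfV// mul1r.
    by apply/matrixP => x y; rewrite !mxE pE hornerC mulr1.
  have JJ : const_mx 1 *m (const_mx 1 : 'M[R]_N) = N%:R *: const_mx 1 :> 'M[R]_N.
    apply/matrixP => x y; rewrite !mxE; under eq_bigr => z _ do rewrite !mxE mulr1.
    by rewrite sumr_const card_ord mulr1.
  have := Eidem ord0; rewrite /= E0 -scalemxAl -scalemxAr JJ !scalerA.
  have [x _] := gram_ex ord0.
  move/matrixP => /(_ (enum_rank x) (enum_rank x)); rewrite !mxE !mulr1 => cc.
  suff -> : c = 1 by rewrite mulr1.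
  apply: (mulfI c0); rewrite mulr1; apply: (mulfI (invr_neq0 N0)).
  by rewrite -[RHS]cc; field.
exists (fun i : 'I_s.+1 => E i); split.
- move=> i j Eij; apply: contraTeq isT => ij.
  have := Eorth i j (ltn_ord _) (ltn_ord _); rewrite val_eqE (negbTE ij) scale0r -Eij Eidem.
  by move/eqP; rewrite (negbTE (Eneq0 i (ltn_ord i))).
- move=> M; split=> [[Mi M0 Mprim]|[i ->]].
    (* If every M E_i were 0, expanding one factor of M M = M would give M = 0. With M E_i = E_i,
       the orthogonal idempotents E_i and M - E_i sum to M, and primitivity leaves M = E_i. *)
    have [i MEi] : exists i : 'I_s.+1, M *m E i = E i.
      have [c McE] := AE _ Mi.1.
      case: (pickP (fun i : 'I_s.+1 => M *m E i == E i)) => [i /eqP ?|no]; first by exists i.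
      case/eqP: M0; rewrite -Mi.2 {2}McE mulmx_sumr big1// => i _; rewrite -scalemxAr.
      by case: (idem _ Mi i) => ME'; [rewrite ME' scaler0|move/eqP: ME'; rewrite no].
    exists i.
    have [] := Mprim (E i) (M - E i).
    + by split; [exact: EA|].
    + split; first by rewrite rpredB ?EA//; exact: Mi.1.
      by rewrite mulmxBl !mulmxBr Mi.2 comm ?MEi ?Eidem ?subrr ?subr0//; exact: Mi.1.
    + by rewrite mulmxBr comm ?MEi ?Eidem ?subrr//; exact: Mi.1.
    + by rewrite mulmxBl MEi Eidem subrr.
    + by rewrite addrC subrK.
    + by move/eqP; rewrite (negbTE (Eneq0 i (ltn_ord i))).
    + by move/eqP; rewrite subr_eq0 => /eqP.
  split; [by split; [exact: EA|]|exact: Eneq0|].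
  move=> M1 M2 M1i M2i M12 M21 Esum.
  have M1E : M1 *m E i = M1 by rewrite Esum mulmxDr M12 addr0 M1i.2.
  case: (idem _ M1i i); rewrite M1E => M1v; first by left.
  by right; move: Esum; rewrite M1v -[LHS]addr0 => /addrI.
- exact: E0.
have [s0|s0] := posnP s.
  exists (fun=> 1) => i; have i0 : i = 0%N :> nat by have := ltn_ord i; lia.
  rewrite size_poly1 i0 E0 scalerA mulfV// scale1r; split => //.
  by apply/matrixP => x y; rewrite !mxE hornerC.
have [u sizeu uE] := fin_all_exists2 lead.
(* The entries of |T| E_1 are an affine, nonconstant function of the inner products. Composing with
   its inverse expresses |T| E_i through |T| E_1 in the same degree. *)
pose e : 'I_s.+1 := inord 1; have e1 : e = 1%N :> nat by rewrite inordK.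
have size_ue : size (u e) = 2%N by rewrite sizeu e1.
have ueE t : (u e).[t] = (u e)`_0 + (u e)`_1 * t.
  by rewrite horner_coef size_ue !big_ord_recl big_ord0 expr0 expr1 mulr1 addr0.
have ue1 : (u e)`_1 != 0.
  by have := lead_coef_eq0 (u e); rewrite lead_coefE size_ue -size_poly_eq0 size_ue => ->.
exists (fun i : 'I_s.+1 => u i \Po (((u e)`_1)^-1 *: ('X - ((u e)`_0)%:P))) => i; split.
  by rewrite size_comp_poly2// size_scale ?invr_eq0// size_XsubC.
rewrite [LHS]uE [X in map_mx _ X]uE; apply/matrixP => x y; rewrite !mxE horner_comp.
by rewrite hornerZ hornerXsubC ueE addrAC subrr add0r mulKf.
Qed.
End GramScheme.

(** The trace is the squared Frobenius norm of H^T K. *)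
Lemma mxtrace_gram_ge0 (R : realFieldType) n p q (H : 'M[R]_(n, p)) (K : 'M[R]_(n, q)) :
  0 <= \tr ((H *m H^T) *m (K *m K^T)).
Proof.
have -> : \tr ((H *m H^T) *m (K *m K^T)) = \tr ((H^T *m K) *m (H^T *m K)^T).
  by rewrite trmx_mul trmxK -mulmxA mxtrace_mulC !mulmxA.
move: (H^T *m K) => M; apply: sumr_ge0 => i _.
by rewrite mxE; apply: sumr_ge0 => j _; rewrite mxE -expr2 sqr_ge0.
Qed.

Lemma dotpC (R : realType) d (x y : d.-tuple R) : dotp x y = dotp y x.
Proof. by apply: eq_bigr => i _; rewrite mulrC. Qed.

Lemma sphere_dotp1 (R : realType) d (x y : d.-tuple R) :
  sphere x -> sphere y -> dotp x y = 1 -> x = y.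
Proof.
move=> x1 y1 xy1.
have : \sum_i (tnth x i - tnth y i) ^+ 2 = 0.
  transitivity (dotp x x - 2 * dotp x y + dotp y y).
    rewrite /dotp mulr_sumr -sumrB -big_split/=; apply: eq_bigr => i _; ring.
  by rewrite (x1 : dotp x x = 1) (y1 : dotp y y = 1) xy1; ring.
move/eqP; rewrite psumr_eq0 => [/allP xyE|i _]; last exact: sqr_ge0.
apply: eq_from_tnth => i; apply/eqP; rewrite -subr_eq0 -sqrf_eq0.
by apply: xyE; rewrite mem_index_enum.
Qed.

(* In dimension 1 the recurrence coefficient gegenbauer_coef R 1 2 vanishes; the
   only set of degree 1 is then X = {1, -1}, for which b_1 = 0. *)
Lemma sphere1_degree (R : realType) (X : {fset 1.-tuple R}) :
  (forall x, x \in X -> sphere x) ->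
  (degree X <= 1)%N /\ (degree X = 1%N -> b_coef X 1 = 0).
Proof.
move=> Xs.
have dotp1 (x y : 1.-tuple R) : dotp x y = tnth x ord0 * tnth y ord0.
  by rewrite /dotp big_ord1.
have neg x y : x \in X -> y \in X -> x != y -> tnth y ord0 = - tnth x ord0.
  move=> /Xs xs /Xs ys xy.
  have : (tnth y ord0 - tnth x ord0) * (tnth y ord0 + tnth x ord0) = 0.
    rewrite -subr_sqr !expr2 -!dotp1 (xs : dotp x x = 1) (ys : dotp y y = 1); ring.
  move/eqP; rewrite mulf_eq0 subr_eq0 addr_eq0 => /orP[|] /eqP yx //.
  case/eqP: xy; apply: eq_from_tnth => i; rewrite (ord1 i); exact: esym.
have DS : {subset degree_set X <= [fset -1 : R]%fset}.
  move=> t /imfset2P[x xX [y]]; rewrite !inE/= => /andP[yX xy] ->.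
  by rewrite dotp1 (neg x y)// mulrN -dotp1 (Xs x xX : dotp x x = 1).
have DS' : (degree_set X `<=` [fset -1 : R])%fset by apply/fsubsetP.
split; first by have := fsubset_leq_card DS'; rewrite cardfs1.
move=> deg1; have /fset0Pn[t /imfset2P[x xX [y]]] : (degree_set X != fset0)%fset.
  by rewrite -cardfs_gt0 -/(degree X) deg1.
rewrite !inE/= => /andP[yX xy] _.
have XE : X = [fset x; y]%fset.
  apply/fsetP => z; rewrite !inE; apply/idP/orP => [zX|[] /eqP-> //].
  have [zx|zx] := eqVneq z x; [by left|right].
  apply/eqP/eq_from_tnth => i; rewrite (ord1 i).
  by rewrite (neg x y)// (neg x z)// eq_sym.
rewrite /b_coef; apply/eqP; rewrite mulf_eq0; apply/orP; right; apply/eqP.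
have sumX (f : 1.-tuple R -> R) : \sum_(z <- X) f z = f x + f y.
  by rewrite XE big_fsetU1 ?inE//= big_seq_fset1.
rewrite !sumX /gegenbauer/= !hornerZ !hornerX !dotp1 (neg x y)//; ring.
Qed.

(** * The matrices F_k of a spherical set *)

Section SphericalCode.
Variables (R : realType) (d : nat) (X : {fset d.-tuple R}).
Variables (h : nat -> nat) (phi : forall l : nat, 'I_(h l) -> mpoly d R).
Arguments phi : clear implicits.
Hypothesis d0 : (0 < d)%N.
Hypothesis Xs : forall x, x \in X -> sphere x.
Hypothesis phiP : forall l, harm_orthonormal_basis l (phi l).

Let g (x y : X) : R := dotp (val x) (val y).

Let Xs' (x : X) : sphere (val x). Proof. exact/Xs/valP. Qed.

Lemma Fmx_gegenbauer k :
  Fmx X (phi k) = gram_mx g (horner ((#|` X|%:R)^-1 *: gegenbauer R d k)).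
Proof.
have s0 := surface_sphere_neq0 (phiP 0).
apply/matrixP => x y; rewrite /Fmx !mxE hornerZ; congr (_ * _).
rewrite -(addition_formula d0 s0 (phiP k) (Xs' _) (Xs' _)).
by apply: eq_bigr => i _; rewrite !mxE.
Qed.

Lemma mxtrace_Fmx k l : \tr (Fmx X (phi k) *m Fmx X (phi l)) =
  (#|` X|%:R)^-1 ^+ 2 * \sum_(p : X * X)
    (gegenbauer R d k).[g p.1 p.2] * (gegenbauer R d l).[g p.1 p.2].
Proof.
rewrite !Fmx_gegenbauer /mxtrace mulr_sumr -(pair_bigA _ (fun x y : X =>
  (#|` X|%:R)^-1 ^+ 2 * ((gegenbauer R d k).[g x y] * (gegenbauer R d l).[g x y])))/=.
rewrite [RHS](reindex_onto enum_val enum_rank)/=; last by move=> x _; rewrite enum_rankK.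
apply: eq_big => [x|x _]; first by rewrite enum_valK eqxx.
rewrite mxE [RHS](reindex_onto enum_val enum_rank)/=; last by move=> y _; rewrite enum_rankK.
apply: eq_big => [y|y _]; first by rewrite enum_valK eqxx.
rewrite !mxE !hornerZ (_ : g (enum_val y) _ = g (enum_val x) (enum_val y)); last exact: dotpC.
by ring.
Qed.

Lemma b_coefE k : b_coef X k =
  (#|` X|%:R)^-1 * \sum_(p : X * X) (gegenbauer R d k).[g p.1 p.2].
Proof.
rewrite /b_coef; congr (_ * _).
rewrite -(pair_bigA _ (fun x y : X => (gegenbauer R d k).[g x y]))/= big_seq_fsetE/=.
by apply: eq_bigr => x _; rewrite big_seq_fsetE.
Qed.

Lemma Fmx_mul_neq0 w : X != fset0 -> 0 < b_coef X w ->
  (forall k l, (l <= w + degree X)%N -> (k + w < l)%N ->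
    Fmx X (phi k) *m Fmx X (phi l) = 0) ->
  forall k, (k <= degree X)%N -> Fmx X (phi k) *m Fmx X (phi (w + k)%N) != 0.
Proof.
move=> X0 bw orth k ks.
have N0 : (0 : R) < (#|` X|%:R)^-1 by rewrite invr_gt0 ltr0n cardfs_gt0.
have : 0 < \sum_(p : X * X)
    (gegenbauer R d k).[g p.1 p.2] * (gegenbauer R d (w + k)).[g p.1 p.2].
  apply: (trace_recurrence_gt0 (s := degree X) (g := fun p => g p.1 p.2)) ks => //.
  (* In dimension 1, degree 1 gives b_1 = 0, so b_w > 0 rules out w = 1. *)
  - move=> d1; move: (X) (Xs) bw; rewrite d1 => Y Ys bw.
    have [s1 b1] := sphere1_degree Ys; split => // /b1 b10 w1.
    by move: bw; rewrite w1 b10 ltxx.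
  - move=> i j; have := mxtrace_Fmx i j.
    rewrite /Fmx -scalemxAl -scalemxAr scalerA linearZ/= -expr2.
    move/(mulfI (lt0r_neq0 (exprn_gt0 2 N0))) => <-; exact: mxtrace_gram_ge0.
  (* As Q_0 = 1, the sum for the pair (0, w) is |X| b_w. *)
  - move: bw; rewrite b_coefE pmulr_rgt0//; congr (_ < _).
    by apply: eq_bigr => p _; rewrite /gegenbauer/= hornerC mul1r.
  - move=> i j js ij; have := mxtrace_Fmx i j.
    rewrite orth// mxtrace0 => /esym/eqP.
    by rewrite mulf_eq0 gt_eqF ?exprn_gt0//= => /eqP.
apply: contraTneq => FF; have := mxtrace_Fmx k (w + k).
rewrite FF mxtrace0 => /esym/eqP.
by rewrite mulf_eq0 gt_eqF ?exprn_gt0//= => /eqP ->; rewrite ltxx.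
Qed.
End SphericalCode.

Theorem theorem4p10 (R : realType) (d : nat) (X : {fset d.-tuple R})
    (h : nat -> nat) (phi : forall l : nat, 'I_(h l) -> mpoly d R)
    (alpha : (degree X).-tuple R) :
  (0 < d)%N ->
  X != fset0 ->
  (forall x, x \in X -> sphere x) ->
  (forall l, harm_orthonormal_basis l (phi l)) ->
  perm_eq alpha (degree_set X) ->
  (exists w : nat,
      0 < b_coef X w /\
      forall k l : nat,
        (k <= w + degree X)%N -> (l <= w + degree X)%N ->
        (w + 1 <= `|k%:Z - l%:Z|)%N ->
        Fmx X (phi k) *m Fmx X (phi l) = 0) ->
  Q_polynomial_scheme R (inner_rel X alpha).
Proof.
move=> d0 X0 Xs phiP alphaP [w [bw orth]].
have orth' k l : (l <= w + degree X)%N -> (k + w < l)%N ->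
    Fmx X (phi k) *m Fmx X (phi l) = 0 by move=> ls kl; apply: orth; lia.
have Fneq0 := Fmx_mul_neq0 d0 Xs phiP X0 bw orth'.
pose g (x y : X) := dotp (val x) (val y).
pose a := [tuple of 1 :: alpha].
have mem_alpha t : (t \in alpha) = (t \in degree_set X) by rewrite (perm_mem alphaP).
have dot1 (x : X) : dotp (val x) (val x) = 1 by exact/Xs/valP.
have dot_inj (x y : X) : dotp (val x) (val y) = 1 -> x = y.
  by move=> xy; apply/val_inj/sphere_dotp1 => //; exact/Xs/valP.
have a_uniq : uniq a.
  rewrite /= mem_alpha (perm_uniq alphaP) fset_uniq andbT.
  apply/negP => /imfset2P[x xX [y]]; rewrite !inE/= => /andP[yX /eqP xy] /esym xy1.
  by apply: xy; apply: sphere_dotp1 => //; exact: Xs.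
have g_in x y : g x y \in val a.
  rewrite inE mem_alpha; have [<-|xy] := eqVneq x y; first by rewrite /g dot1 eqxx.
  apply/orP; right; apply/imfset2P; exists (val x); first exact: valP.
  by exists (val y) => //; rewrite !inE/= (valP y) (inj_eq val_inj).
have gC x y : g x y = g y x by exact: dotpC.
have gram0 x y : gram_rel a g ord0 x y = (x == y).
  rewrite /gram_rel; apply/eqP/eqP => [/dot_inj//|->]; exact: dot1.
have gram_ex i : exists x y, gram_rel a g i x y.
  have : tnth a i \in (1 :: alpha) by exact: mem_tnth.
  rewrite inE mem_alpha => /orP[/eqP ai|/imfset2P[x xX [y]]].
    have /fset0Pn[x xX] := X0; exists [` xX]%fset, [` xX]%fset.
    by rewrite /gram_rel ai /g dot1.
  rewrite !inE/= => /andP[yX _] ai; exists [` xX]%fset, [` yX]%fset.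
  by rewrite /gram_rel ai.
have FE k := Fmx_gegenbauer d0 Xs phiP k.
have size_q k : size ((#|` X|%:R)^-1 *: gegenbauer R d k) = k.+1.
  by rewrite size_scale ?size_gegenbauer// invr_eq0 pnatr_eq0 cardfs_eq0.
split.
  exact: (gram_association_scheme a_uniq g_in gC gram0 gram_ex FE orth' Fneq0).
exact: (gram_Q_polynomial a_uniq g_in gC gram0 gram_ex FE size_q orth' Fneq0).
Qed.
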